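(* Let $\Gamma$ be a finite connected graph without loops, with a Hamiltonian $\mathcal H$ and associated Lagrangian $\mathcal L$. For every $c\in H^1(\Gamma,\mathbb R)$, the projected Mather set $\mathcal M_c:=\pi_E(\widetilde{\mathcal M}_c)$ satisfies $$\mathcal M_c\subseteq\mathcal A_c .$$ In particular, equality holds if $c$ is such that $\alpha(c)>\min\alpha$.
   Context: Graph. $\Gamma=(V,E)$ consists of disjoint finite sets $V$ (vertices) and $E\neq\emptyset$ (directed edges), a map $o:E\to V$ (origin) and a fixed-point-free involution $e\mapsto -e$ of $E$; $t(e):=o(-e)$. A path is a finite sequence of edges $(e_i)_{i=1}^M$ with $t(e_i)=o(e_{i+1})$; it is closed (a cycle) if $o(e_1)=t(e_M)$. $\Gamma$ is connected (any two vertices are linked by a path) and has no loops ($o(e)\ne t(e)$). (Co)homology. $C_0$ is the real vector space with basis $V$; $C_1$ is the real vector space generated by $E$ with the edge $-e$ identified with the opposite of $e$; $\partial e=t(e)-o(e)$; $H_1(\Gamma,\mathbb R)=\ker\partial\subset C_1$. $C^0$ = functions $V\to\mathbb R$; $C^1$ = functions $\omega:E\to\mathbb R$ with $\omega(-e)=-\omega(e)$; $dg(e)=g(t(e))-g(o(e))$; $H^1(\Gamma,\mathbb R)=C^1/dC^0$. The pairing $\langle\omega,e\rangle=\omega(e)$ extends linearly to $C^1\times C_1$ and descends to $H^1\times H_1$. Tangent bundle and measures. $T\Gamma=(E\times[0,+\infty))/\sim$, where $(e,0)\sim(-e,0)$; $\mathbb R^+_e:=\{e\}\times[0,+\infty)$.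 The metric is $d((e_1,q_1),(e_2,q_2))=q_1+q_2+1$ if $e_1\ne\pm e_2$, $|q_1-q_2|$ if $e_1=e_2$, $q_1+q_2$ if $e_1=-e_2$. $\mathbb P$ is the set of Borel probability measures on $T\Gamma$ with $\int q\,d\mu<+\infty$. For $\mu\in\mathbb P$, $\rho(\mu)=\sum_{e\in E}\big(\int_{\mathbb R^+_e}q\,d\mu\big)e\in C_1$ and, for $\omega\in C^1$, $\int\omega\,d\mu:=\langle\omega,\rho(\mu)\rangle$. $\mu$ is closed if $\int df\,d\mu=0$ for all $f\in C^0$, equivalently $\rho(\mu)\in H_1(\Gamma,\mathbb R)$; $\mathbb M\subset\mathbb P$ is the set of closed measures. Hamiltonian and Lagrangian. A Hamiltonian is a family $\mathcal H(e,\cdot):\mathbb R\to\mathbb R$, $e\in E$, with $\mathcal H(e,p)=\mathcal H(-e,-p)$, each strictly convex, differentiable and superlinear ($\mathcal H(e,p)/|p|\to+\infty$ as $p\to\pm\infty$). $p_e$ is the minimizer of $\mathcal H(e,\cdot)$, $a_e=\mathcal H(e,p_e)=a_{-e}$, and $\sigma(e,\cdot):[a_e,+\infty)\to[p_e,+\infty)$ is the inverse of $\mathcal H(e,\cdot)$ restricted to $[p_e,+\infty)$. $\mathcal L(e,q)=\max_p(pq-\mathcal H(e,p))$, well defined on $T\Gamma$. For $\omega\in C^1$: $\mathcal H^\omega(e,p)=\mathcal H(e,p+\omega(e))$, $\mathcal L^\omega(e,q)=\mathcal L(e,q)-q\,\omega(e)$, $\sigma^\omega(e,a)=\sigma(e,a)-\omega(e)$.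 For a path $\xi=(e_i)_{i=1}^M$ and $a\ge\max_ea_e$, $\sigma^\omega(\xi,a)=\sum_i\sigma^\omega(e_i,a)$. Mather theory. $\beta(h)=\min\{\int\mathcal L\,d\mu:\mu\in\mathbb M,\rho(\mu)=h\}$; $\alpha(c)=\max_h(\langle c,h\rangle-\beta(h))=-\min_{\mu\in\mathbb M}\int\mathcal L^\omega d\mu$ for any representative $\omega$ of $c$. $\mathbb M_c$ is the set of $\mu\in\mathbb M$ with $\int\mathcal L^\omega d\mu=-\alpha(c)$, and $\widetilde{\mathcal M}_c=\bigcup_{\mu\in\mathbb M_c}\operatorname{supp}\mu\subset T\Gamma$. $\pi_E$ is the multivalued projection $\pi_E(e,q)=\{e\}$ if $q>0$, $\pi_E(e,0)=\{e,-e\}$; the image of a set is the union of the images of its points. Weak KAM objects. A function $u:V\to\mathbb R$ is a subsolution at level $a$ if $\max_{e:\,t(e)=x}\mathcal H^\omega(e,du(e))\le a$ for every $x\in V$. The critical value $\widetilde\alpha(c)$ is the minimum of the $a\in\mathbb R$ for which subsolutions at level $a$ exist; it depends only on the class $c$ of $\omega$ and is $\ge\max_ea_e$. The Aubry set $\mathcal A_c\subset E$ is the set of edges belonging to some cycle $\xi$ with $\sigma^\omega(\xi,\widetilde\alpha(c))=0$ (independent of the representative $\omega$). *)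

(* Defs.v *)
From HB Require Import structures.
From mathcomp Require Import all_boot all_order all_algebra.
From mathcomp Require Import all_classical all_reals all_analysis.
From mathcomp Require Import lra.
Import Order.TTheory GRing.Theory Num.Theory.
Import numFieldNormedType.Exports.

Set Implicit Arguments.
Unset Strict Implicit.
Unset Printing Implicit Defensive.

Local Open Scope classical_set_scope.
Local Open Scope quotient_scope.
Local Open Scope ring_scope.

Record graph := Graph {
  vertex : finType;
  edge : finType;
  orig : edge -> vertex;
  erev : edge -> edge;
  revK : involutive erev;
  rev_neq : forall e, erev e != e;
  edge_gt0 : (0 < #|edge|)%N }.

Definition term (G : graph) (e : edge G) : vertex G := orig (erev e).

Definition follows (G : graph) : rel (edge G) := fun e e' => term e == orig e'.

Definition connected_graph (G : graph) : Prop :=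
  forall x y : vertex G, x != y ->
    exists e s, [/\ path (@follows G) e s, orig e = x & term (last e s) = y].

Definition loopless (G : graph) : Prop := forall e : edge G, orig e != term e.

(* A nonempty sequence [xi] of edges satisfies [is_cycle xi] when consecutive
   edges are composable and the terminus of the last one is the origin of the
   first one; the empty sequence also satisfies it. *)
Definition is_cycle (G : graph) (xi : seq (edge G)) : Prop :=
  cycle (@follows G) xi.

Section Cohomology.
Variables (R : realType) (G : graph).

Definition chain0 : Type := {ffun vertex G -> R}.

Definition vbasis (x : vertex G) : chain0 := [ffun y => (y == x)%:R].

(* C_1 is the free vector space on the edges modulo the span of the chains
   e + (-e), which is the space of functions invariant under [erev]. *)
Definition rev_invariant : {pred {ffun edge G -> R}} :=
  fun f => [forall e, f (erev e) == f e].

Lemma rev_invariant_zmod : zmod_closed rev_invariant.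
Proof.
split; first by apply/forallP => e; rewrite !ffunE.
move=> f g /forallP fi /forallP gi; apply/forallP => e.
by rewrite !ffunE (eqP (fi e)) (eqP (gi e)).
Qed.

HB.instance Definition _ :=
  GRing.isZmodClosed.Build {ffun edge G -> R} rev_invariant rev_invariant_zmod.

Definition chain1 : Type := {ideal_quot rev_invariant}.

Definition antisymmetric_cochain : {pred {ffun edge G -> R}} :=
  fun w => [forall e, w (erev e) == - w e].

Lemma antisymmetric_cochain_submod : submod_closed antisymmetric_cochain.
Proof.
split; first by apply/forallP => e; rewrite !ffunE oppr0.
move=> a f g /forallP fi /forallP gi; apply/forallP => e.
by rewrite !ffunE (eqP (fi e)) (eqP (gi e)) /= scalerN opprD.
Qed.

HB.instance Definition _ := GRing.isSubmodClosed.Build R {ffun edge G -> R}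
  antisymmetric_cochain antisymmetric_cochain_submod.

Definition cochain0 : Type := vertex G -> R.

Record cochain1 : Type := Cochain1 {
  cochain1_val :> {ffun edge G -> R};
  cochain1P : cochain1_val \in antisymmetric_cochain }.

HB.instance Definition _ := [isSub for cochain1_val].
HB.instance Definition _ := [Choice of cochain1 by <:].
HB.instance Definition _ := [SubChoice_isSubLmodule of cochain1 by <:].

Lemma cochain1_rev (w : cochain1) e : w (erev e) = - w e.
Proof. by have /forallP/(_ e)/eqP := cochain1P w. Qed.

Definition differential_val (g : cochain0) : {ffun edge G -> R} :=
  [ffun e => g (term e) - g (orig e)].

Lemma differential_subproof g : differential_val g \in antisymmetric_cochain.
Proof. by apply/forallP => e; rewrite !ffunE /term revK opprB. Qed.

Definition differential (g : cochain0) : cochain1 :=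
  Cochain1 (differential_subproof g).

Definition exact_cochain : {pred cochain1} :=
  fun w => `[< exists g, w = differential g >].

Lemma exact_cochain_zmod : zmod_closed exact_cochain.
Proof.
split.
  apply/asboolP; exists (fun=> 0); apply: val_inj.
  by apply/ffunP => e; rewrite !ffunE subrr.
move=> w w' /asboolP[g ->] /asboolP[g' ->]; apply/asboolP.
exists (fun x => g x - g' x); apply: val_inj; apply/ffunP => e.
by rewrite !ffunE; lra.
Qed.

HB.instance Definition _ :=
  GRing.isZmodClosed.Build cochain1 exact_cochain exact_cochain_zmod.

Definition cohomology1 : Type := {ideal_quot exact_cochain}.

(* Linear maps out of a quotient are given by their value on a representative;
   the companion lemmas state that the choice is irrelevant. *)

Definition boundary (h : chain1) : chain0 :=
  \sum_e (repr h : {ffun _}) e *: (vbasis (term e) - vbasis (orig e)).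

Definition pairing (w : cochain1) (h : chain1) : R :=
  \sum_e (repr h : {ffun _}) e * w e.

Definition homology1 : set chain1 := [set h | boundary h = 0].

Definition pairing_class (c : cohomology1) (h : chain1) : R :=
  pairing (repr c) h.

Lemma rev_invariant_repr (f : {ffun edge G -> R}) e :
  (repr (\pi_chain1 f) - f) (erev e) = (repr (\pi_chain1 f) - f) e.
Proof.
suff /forallP/(_ e)/eqP : repr (\pi_chain1 f) - f \in rev_invariant by [].
by have := @Quotient.idealrBE _ rev_invariant (repr (\pi_chain1 f)) f;
  rewrite reprK eqxx => ->.
Qed.

Lemma sum_antisym0 (V : lmodType R) (F : edge G -> V) :
  (forall e, F (erev e) = - F e) -> \sum_e F e = 0.
Proof.
move=> Frev; have : \sum_e F e = - \sum_e F e.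
  rewrite [LHS](reindex_inj (inv_inj (@revK G))) /= -sumrN.
  by apply: eq_bigr => e _; rewrite Frev.
move/eqP; rewrite -subr_eq0 opprK -mulr2n -scaler_nat scaler_eq0.
by rewrite pnatr_eq0 /= => /eqP.
Qed.

Lemma boundary_pi (f : {ffun edge G -> R}) :
  boundary (\pi_chain1 f) =
  \sum_e f e *: (vbasis (term e) - vbasis (orig e)).
Proof.
apply/eqP; rewrite -subr_eq0 /boundary -sumrB.
under eq_bigr => e _ do rewrite -scalerBl.
apply/eqP; apply: sum_antisym0 => e.
have := rev_invariant_repr f e; rewrite !ffunE => ->.
by rewrite /term revK -scalerN opprB.
Qed.

Lemma pairing_pi (w : cochain1) (f : {ffun edge G -> R}) :
  pairing w (\pi_chain1 f) = \sum_e f e * w e.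
Proof.
apply/eqP; rewrite -subr_eq0 /pairing -sumrB.
under eq_bigr => e _ do rewrite -mulrBl.
apply/eqP; apply: (@sum_antisym0 R^o) => e.
have := rev_invariant_repr f e; rewrite !ffunE => ->.
by rewrite cochain1_rev mulrN.
Qed.

Lemma pairing_differential (g : cochain0) (h : chain1) :
  homology1 h -> pairing (differential g) h = 0.
Proof.
rewrite /homology1 /boundary /= => h0.
transitivity (\sum_x g x * (boundary h) x).
  under [RHS]eq_bigr => x _ do rewrite sum_ffunE mulr_sumr.
  rewrite exchange_big /=; apply: eq_bigr => e _.
  rewrite (eq_bigr (fun x => (repr h : {ffun _}) e * (g x * (x == term e)%:R)
     - (repr h : {ffun _}) e * (g x * (x == orig e)%:R))); last first.
    by move=> x _; rewrite !ffunE /= /GRing.scale /=; lra.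
  rewrite sumrB -!mulr_sumr !ffunE mulrBr.
  have s (y : vertex G) : \sum_x g x * (x == y)%:R = g y.
    rewrite (bigD1 y) //= eqxx mulr1 big1 ?addr0 // => x /negbTE ->.
    by rewrite mulr0.
  by rewrite !s.
by rewrite /boundary h0; apply: big1 => x _; rewrite ffunE mulr0.
Qed.

Lemma pairing_class_pi (w : cochain1) (h : chain1) :
  homology1 h -> pairing_class (\pi_cohomology1 w) h = pairing w h.
Proof.
move=> hh; have : repr (\pi_cohomology1 w) - w \in exact_cochain.
  by have := @Quotient.idealrBE _ exact_cochain (repr (\pi_cohomology1 w)) w;
    rewrite reprK eqxx => ->.
move=> /asboolP[g /(congr1 (fun v => pairing v h))].
rewrite (pairing_differential _ hh) => H.
apply/eqP; rewrite -subr_eq0 -[X in _ == X]H.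
rewrite /pairing_class /pairing -sumrB; apply/eqP; apply: eq_bigr => e _.
by rewrite -mulrBr !ffunE.
Qed.

End Cohomology.

Section Tangent.
Variables (R : realType) (G : graph).

Notation pretangent := (edge G * {nonneg R})%type.

Definition tangent_equiv : rel pretangent := fun x y =>
  (x == y) ||
  [&& y.1 == erev x.1, x.2%:num == 0 :> R & y.2%:num == 0 :> R].

Lemma tangent_equiv_refl : reflexive tangent_equiv.
Proof. by move=> x; rewrite /tangent_equiv eqxx. Qed.

Lemma tangent_equiv_sym : symmetric tangent_equiv.
Proof.
move=> x y; rewrite /tangent_equiv eq_sym (eq_sym y.1).
by rewrite (can2_eq (@revK G) (@revK G)) (andbC (_ == 0)).
Qed.

Lemma tangent_equiv_trans : transitive tangent_equiv.
Proof.
move=> [e2 q2] [e1 q1] [e3 q3]; rewrite /tangent_equiv /=.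
case/orP => [/eqP[-> ->] //|/and3P[/eqP e21 q10 q20]].
case/orP => [/eqP[<- <-]|/and3P[/eqP e32 _ q30]].
  by rewrite e21 eqxx q10 q20 orbT.
apply/orP; left; rewrite e32 e21 revK; apply/eqP; congr pair.
by apply/val_inj; rewrite /= (eqP q10) (eqP q30).
Qed.

Canonical tangent_equiv_rel := EquivRel tangent_equiv
  tangent_equiv_refl tangent_equiv_sym tangent_equiv_trans.

Definition tangent : Type := {eq_quot tangent_equiv}.

HB.instance Definition _ := Choice.on tangent.
HB.instance Definition _ := EqQuotient.on tangent.

Definition predist (x y : pretangent) : R :=
  if x.1 == y.1 then `|x.2%:num - y.2%:num|
  else if x.1 == erev y.1 then x.2%:num + y.2%:num
  else x.2%:num + y.2%:num + 1.

Lemma predist_equivl x y z : tangent_equiv x y -> predist x z = predist y z.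
Proof.
case: x y z => [e q] [e' q'] [f r]; rewrite /tangent_equiv /predist /=.
case/orP => [/eqP[-> ->] //|/and3P[/eqP-> /eqP q0 /eqP q'0]].
rewrite q0 q'0 (inj_eq (inv_inj (@revK G))) sub0r normrN ger0_norm //.
rewrite (can2_eq (@revK G) (@revK G)).
by have [->|_] := eqVneq e f; rewrite ?[f == erev f]eq_sym ?(negbTE (rev_neq f))
  ?add0r //; case: ifP.
Qed.

Lemma predist_sym x y : predist x y = predist y x.
Proof.
rewrite /predist [y.1 == x.1]eq_sym distrC [y.1 == erev _]eq_sym.
rewrite (can2_eq (@revK G) (@revK G)).
by do 2 case: ifP => _ //; lra.
Qed.

Lemma predist_triangle y x z : predist x z <= predist x y + predist y z.
Proof.
case: x y z => [e1 q1] [e2 q2] [e3 q3]; rewrite /predist /=.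
have [h1 h2 h3] : [/\ 0 <= q1%:num, 0 <= q2%:num & 0 <= q3%:num] by [].
move: (q1%:num) (q2%:num) (q3%:num) h1 h2 h3 => a1 a2 a3 h1 h2 h3.
have le13 : `|a1 - a3| <= a1 + a3.
  by rewrite ler_norml; apply/andP; split; lra.
have tri13 := ler_distD a2 a1 a3.
have n12 := ler_norm (a1 - a2); have n23 := ler_norm (a2 - a3).
have n21 := ler_norm (a2 - a1); have n32 := ler_norm (a3 - a2).
rewrite distrC in n21; rewrite distrC in n32.
case: (boolP (e1 == e2)) => [/eqP ?|d12]; first subst e1.
  case: (boolP (e2 == e3)) => [/eqP ?|d23]; first by [].
  by case: ifP => _; lra.
case: (boolP (e2 == e3)) => [/eqP ?|d23].
  by subst e2; rewrite (negbTE d12); case: ifP => _; lra.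
case: (boolP (e1 == erev e2)) => [/eqP ?|r12]; last first.
  by case: ifP => _; case: ifP => _; try case: ifP => _; lra.
subst e1; case: (boolP (e2 == erev e3)) => [/eqP ?|r23].
  by subst e2; rewrite revK eqxx; lra.
rewrite (inj_eq (inv_inj (@revK G))) (negbTE d23).
by case: ifP => _; lra.
Qed.

Definition tdist (x y : tangent) : R := predist (repr x) (repr y).

Lemma tdist_pi (x y : pretangent) :
  tdist (\pi_tangent x) (\pi_tangent y) = predist x y.
Proof.
have reqv z : tangent_equiv (repr (\pi_tangent z)) z.
  by apply/(@eqmodP _ tangent_equiv_rel); rewrite reprK.
rewrite /tdist (predist_equivl _ (reqv x)) predist_sym.
by rewrite (predist_equivl _ (reqv y)) predist_sym.
Qed.

Lemma tdistxx x : tdist x x = 0.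
Proof. by rewrite /tdist /predist eqxx subrr normr0. Qed.

Lemma tdist_eq0 x y : tdist x y = 0 -> x = y.
Proof.
rewrite -[x]reprK -[y]reprK tdist_pi.
case: (repr x) (repr y) => [e1 q1] [e2 q2] d0.
apply/(@eqmodP _ tangent_equiv_rel); move: d0.
have [h1 h2] : 0 <= q1%:num /\ 0 <= q2%:num by [].
rewrite /predist /= /tangent_equiv /= xpair_eqE.
case: (e1 == e2) => [/eqP|].
  by rewrite normr_eq0 subr_eq0 -(inj_eq val_inj) /= => ->.
case: (boolP (e1 == erev e2)) => [/eqP -> d0|_]; last by lra.
rewrite revK eqxx /=; apply/andP; split; apply/eqP; lra.
Qed.

Lemma tdist_sym x y : tdist x y = tdist y x.
Proof. exact: predist_sym. Qed.

Lemma tdist_triangle y x z : tdist x z <= tdist x y + tdist y z.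
Proof. exact: predist_triangle. Qed.

HB.instance Definition _ :=
  isMetric.Build R tangent tdistxx tdist_eq0 tdist_sym tdist_triangle.

Definition point_tangent : tangent :=
  \pi_tangent (xchoose (elimT card_gt0P (edge_gt0 G)), 0%:nng).

HB.instance Definition _ := isPointed.Build tangent point_tangent.

Definition tborel : Type := g_sigma_algebraType (@open tangent).

HB.instance Definition _ := Measurable.on tborel.

(* Only meaningful up to [erev] at the points of speed 0. *)
Definition tedge (x : tangent) : edge G := (repr x).1.

Definition speed (x : tangent) : R := (repr x).2%:num.

Definition half_line (e : edge G) : set tangent :=
  [set \pi_tangent (e, q) | q in [set: {nonneg R}]].

Definition edge_proj (x : tangent) : set (edge G) :=
  if 0 < speed x then [set tedge x] else [set tedge x; erev (tedge x)].

Definition msupport (mu : set tborel -> \bar R) : set tangent :=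
  [set x | forall U : set tangent, open U -> U x -> (0 < mu U)%E].

End Tangent.

Section Hamiltonian.
Variables (R : realType) (G : graph).

Definition strictly_convex (f : R -> R) : Prop :=
  forall x y t, x != y -> 0 < t < 1 ->
    f (t * x + (1 - t) * y) < t * f x + (1 - t) * f y.

Definition superlinear (f : R -> R) : Prop :=
  f p / `|p| @[p --> +oo] --> +oo /\ f p / `|p| @[p --> -oo] --> +oo.

Record hamiltonian := Hamiltonian {
  ham :> edge G -> R -> R;
  ham_rev : forall e p, ham e p = ham (erev e) (- p);
  ham_strictly_convex : forall e, strictly_convex (ham e);
  ham_derivable : forall e p, derivable (ham e) p 1;
  ham_superlinear : forall e, superlinear (ham e) }.

Variable H : hamiltonian.

Definition minimizer (e : edge G) : R :=
  xget 0 [set p | forall p', H e p <= H e p'].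

(* For [a] below the minimum of [H e] the value is a dummy one. *)
Definition sigma (e : edge G) (a : R) : R :=
  xget 0 [set p | minimizer e <= p /\ H e p = a].

(* The supremum is a maximum, by superlinearity. *)
Definition lagrangian (e : edge G) (q : R) : R :=
  sup [set p * q - H e p | p in [set: R]].

Definition ham_cochain (w : cochain1 R G) (e : edge G) (p : R) : R :=
  H e (p + w e).

Definition tangent_lagrangian (x : tangent R G) : R :=
  lagrangian (tedge x) (speed x).

Definition lagrangian_cochain (w : cochain1 R G) (x : tangent R G) : R :=
  tangent_lagrangian x - speed x * w (tedge x).

Definition sigma_cochain (w : cochain1 R G) (e : edge G) (a : R) : R :=
  sigma e a - w e.

Definition sigma_path (w : cochain1 R G) (xi : seq (edge G)) (a : R) : R :=
  \sum_(e <- xi) sigma_cochain w e a.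

Lemma lagrangian_rev0 e : lagrangian (erev e) 0 = lagrangian e 0.
Proof.
rewrite /lagrangian; congr sup; apply/seteqP; split => _ [p _ <-] /=.
  by exists (- p) => //; rewrite !mulr0 (ham_rev H e) opprK.
by exists (- p) => //; rewrite !mulr0 (ham_rev H e).
Qed.

Lemma lagrangian_cochain_pi w e (q : {nonneg R}) :
  lagrangian_cochain w (\pi_(tangent R G) (e, q)) =
  lagrangian e q%:num - q%:num * w e.
Proof.
have : tangent_equiv (repr (\pi_(tangent R G) (e, q))) (e, q).
  by apply/(@eqmodP _ (tangent_equiv_rel R G)); rewrite reprK.
rewrite /lagrangian_cochain /tangent_lagrangian /tedge /speed /tangent_equiv.
case: (repr _) => e' q' /=.
case/orP => [/eqP[-> ->] //|/and3P[/eqP-> /eqP-> /eqP->]].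
by rewrite lagrangian_rev0 !mul0r.
Qed.

Definition finite_moment : set (probability (tborel R G) R) :=
  [set mu : probability (tborel R G) R | (\int[mu]_x (speed x)%:E < +oo)%E].

Definition rotation (mu : probability (tborel R G) R) : chain1 R G :=
  \pi_(chain1 R G) [ffun e => \int[mu]_(x in half_line e) speed x].

Definition cochain_integral (w : cochain1 R G)
    (mu : probability (tborel R G) R) : R :=
  pairing w (rotation mu).

Definition closed_measures : set (probability (tborel R G) R) :=
  [set mu | finite_moment mu /\
    forall f : cochain0 R G, cochain_integral (differential f) mu = 0].

(* The Lagrangians are bounded below by an affine function of the speed, so on
   closed measures this integral is well defined in ]-oo, +oo]. *)
Definition action (w : cochain1 R G) (mu : probability (tborel R G) R) :
    \bar R :=
  (\int[mu]_x (lagrangian_cochain w x)%:E)%E.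

(* Minima and maxima over sets of extended reals are written [ereal_inf] and
   [ereal_sup]: for [h] in H_1 and any class [c] they are attained and finite. *)
Definition beta (h : chain1 R G) : \bar R :=
  ereal_inf [set (\int[mu]_x (tangent_lagrangian x)%:E)%E |
    mu in closed_measures `&` [set mu | rotation mu = h]].

Definition alpha (c : cohomology1 R G) : \bar R :=
  ereal_sup [set ((pairing_class c h)%:E - beta h)%E | h in @homology1 R G].

(* Objects attached to a class [c] are computed on the representative [repr c],
   whose choice is irrelevant: two representatives have the same action on every
   closed measure, and see [critical_value_pi] and [aubry_set_pi] below. *)
Definition minimizing_measures (c : cohomology1 R G) :
    set (probability (tborel R G) R) :=
  [set mu | closed_measures mu /\ action (repr c) mu = (- alpha c)%E].

Definition mather_set (c : cohomology1 R G) : set (tangent R G) :=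
  \bigcup_(mu in minimizing_measures c) msupport mu.

Definition projected_mather_set (c : cohomology1 R G) : set (edge G) :=
  \bigcup_(x in mather_set c) edge_proj x.

(* The maximum over the edges ending at [x] is at most [a] iff each term is. *)
Definition subsolution (w : cochain1 R G) (a : R) (u : vertex G -> R) : Prop :=
  forall (x : vertex G) (e : edge G), term e = x ->
    ham_cochain w e (differential u e) <= a.

(* The infimum is a minimum. *)
Definition critical_value_cochain (w : cochain1 R G) : R :=
  inf [set a | exists u, subsolution w a u].

Definition critical_value (c : cohomology1 R G) : R :=
  critical_value_cochain (repr c).

Definition aubry_set_cochain (w : cochain1 R G) : set (edge G) :=
  [set e | exists xi, [/\ is_cycle xi, e \in xi &
    sigma_path w xi (critical_value_cochain w) = 0]].

Definition aubry_set (c : cohomology1 R G) : set (edge G) :=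
  aubry_set_cochain (repr c).

Lemma subsolution_differential w g a u :
  subsolution (w + differential g) a u <->
  subsolution w a (fun x => u x + g x).
Proof.
by split=> su x e /(su x); apply: le_trans; rewrite le_eqVlt; apply/orP; left;
  apply/eqP; congr (H _ _); rewrite !ffunE; lra.
Qed.

Lemma critical_value_cochain_differential w g :
  critical_value_cochain (w + differential g) = critical_value_cochain w.
Proof.
congr inf; apply/seteqP; split => a [u su].
  by exists (fun x => u x + g x); apply/subsolution_differential.
exists (fun x => u x - g x); apply/subsolution_differential.
by under eq_fun do rewrite subrK.
Qed.

Lemma sum_differential_cycle (g : cochain0 R G) (xi : seq (edge G)) :
  is_cycle xi -> \sum_(e <- xi) differential g e = 0.
Proof.
case: xi => [|e s]; first by rewrite big_nil.
rewrite /is_cycle /= rcons_path => /andP[pth /eqP last_e].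
have -> : \sum_(f <- e :: s) differential g f =
          g (term (last e s)) - g (orig e).
  elim: s e {last_e} pth => [|e' s IH] e /=.
    by rewrite big_seq1 ffunE.
  move=> /andP[/eqP ee' pth]; rewrite big_cons (IH _ pth) -ee' ffunE.
  by rewrite addrC addrA subrK.
by rewrite last_e subrr.
Qed.

Lemma aubry_set_cochain_differential w g :
  aubry_set_cochain (w + differential g) = aubry_set_cochain w.
Proof.
apply/seteqP; split => e [xi [cxi exi xi0]]; exists xi; split=> //;
  rewrite -[RHS]xi0 critical_value_cochain_differential /sigma_path;
  apply/eqP; rewrite -subr_eq0 -sumrB.
  rewrite (eq_bigr (differential g)) ?sum_differential_cycle // => f _.
  by rewrite /sigma_cochain !ffunE; lra.
rewrite (eq_bigr (fun e => - differential g e)).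
  by rewrite sumrN sum_differential_cycle ?oppr0.
by move=> f _; rewrite /sigma_cochain !ffunE; lra.
Qed.

Lemma repr_cohomology1 (w : cochain1 R G) :
  exists g, repr (\pi_(cohomology1 R G) w) = w + differential g.
Proof.
have : repr (\pi_(cohomology1 R G) w) - w \in @exact_cochain R G.
  by have := @Quotient.idealrBE _ (@exact_cochain R G)
    (repr (\pi_(cohomology1 R G) w)) w;
    rewrite reprK eqxx => ->.
by move=> /asboolP[g gE]; exists g; rewrite -gE addrC subrK.
Qed.

Lemma critical_value_pi w :
  critical_value (\pi_(cohomology1 R G) w) = critical_value_cochain w.
Proof.
rewrite /critical_value; have [g ->] := repr_cohomology1 w.
exact: critical_value_cochain_differential.
Qed.

Lemma aubry_set_pi w :
  aubry_set (\pi_(cohomology1 R G) w) = aubry_set_cochain w.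
Proof.
rewrite /aubry_set; have [g ->] := repr_cohomology1 w.
exact: aubry_set_cochain_differential.
Qed.

End Hamiltonian.

(* Main.v *)
(* If [u] is a critical subsolution, Fenchel's inequality bounds the action of
   every closed measure below by minus the critical value, and equality forces
   the support to lie where the Fenchel defect of [w + du] vanishes, i.e. on
   edges with [du e = sigma^w(e, critical value)].  The rotation of a minimizing
   measure is a circulation, so an edge carrying mass at positive speed lies on a
   cycle of such edges, along which [sigma^w] telescopes to 0; a point of speed 0
   gives the cycle [e, -e].

   The bound is attained: some simple cycle has [sigma^w <= 0] at the critical
   level, as otherwise a potential would exist slightly below it, and the masses
   1/q on the edges of this cycle, with q dual to [sigma], give a closed
   minimizing measure (when some q is 0, a Dirac mass at rest does).  If [alpha]
   is not minimal at [c] then all the q are positive, so the same measure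
   realizes every cycle of the Aubry set. *)
Require Import Defs.
From HB Require Import structures.
From mathcomp Require Import all_boot all_order all_algebra.
From mathcomp Require Import all_classical all_reals all_analysis.
From mathcomp Require Import measurable_realfun.
From mathcomp Require Import ring lra zify.
Import Order.TTheory GRing.Theory Num.Theory.
Import numFieldNormedType.Exports.

Set Implicit Arguments.
Unset Strict Implicit.
Unset Printing Implicit Defensive.

Local Open Scope classical_set_scope.
Local Open Scope quotient_scope.
Local Open Scope ring_scope.

(** * Strictly convex functions of one real variable *)

Section StrictConvexity.
Variables (R : realType) (f : R -> R).
Hypothesis f_convex : strictly_convex f.

(** Convexity at the barycentre [y] of [x] and [z], with denominators cleared so that later uses are
    polynomial. *)
Lemma strictly_convex_between x y z : x < y -> y < z ->
  (z - x) * f y < (z - y) * f x + (y - x) * f z.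
Proof.
move=> xy yz; have xz : 0 < z - x by lra.
have t01 : 0 < (z - y) / (z - x) < 1.
  by rewrite divr_gt0 ?ltr_pdivrMr; lra.
have xz_neq : x != z by rewrite lt_eqF // (lt_trans xy yz).
have := f_convex xz_neq t01.
have -> : (z - y) / (z - x) * x + (1 - (z - y) / (z - x)) * z = y.
  by field; lra.
rewrite -(ltr_pM2l xz) => /lt_le_trans; apply.
by rewrite le_eqVlt; apply/orP; left; apply/eqP; field; lra.
Qed.

Lemma strictly_convex_lt x y z a :
  x < y -> y < z -> f x <= a -> f z <= a -> f y < a.
Proof. by move=> xy yz xa za; have := strictly_convex_between xy yz; nra. Qed.

(** The slope is the supremum of the chord slopes to the left of [x]; every chord slope to the right
    bounds that set, which gives finiteness and the inequality on the right. *)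
Lemma strictly_convex_subgradient x :
  exists q, forall y, f x + q * (y - x) <= f y.
Proof.
pose S := [set (f x - f y) / (x - y) | y in [set y | y < x]].
have ubS z : x < z -> ubound S ((f z - f x) / (z - x)).
  move=> xz _ [y /= yx <-]; rewrite ler_pdivrMr; last lra.
  rewrite mulrAC ler_pdivlMr; last lra.
  by have := strictly_convex_between yx xz; lra.
have hS : has_sup S.
  split; first by exists ((f x - f (x - 1)) / (x - (x - 1))), (x - 1) => //=; lra.
  by exists ((f (x + 1) - f x) / (x + 1 - x)); apply: ubS; lra.
exists (sup S) => y; case: (ltgtP y x) => [yx|xy|->]; last by lra.
- have : (f x - f y) / (x - y) <= sup S by apply: (ub_le_sup hS.2); exists y.
  by rewrite ler_pdivrMr; lra.
- have : sup S <= (f y - f x) / (y - x) by apply: (ge_sup hS.1); apply: ubS.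
  by rewrite ler_pdivlMr; lra.
Qed.

Variable p0 : R.
Hypothesis p0_min : forall p, f p0 <= f p.

Lemma strictly_convex_min_unique p : f p <= f p0 -> p = p0.
Proof.
move=> fp; case: (ltgtP p p0) => // [lt1|lt1].
- have h : p < (p + p0) / 2 by lra.
  have h' : (p + p0) / 2 < p0 by lra.
  by have := strictly_convex_lt h h' fp (lexx _); have := p0_min ((p + p0) / 2); lra.
- have h : p0 < (p + p0) / 2 by lra.
  have h' : (p + p0) / 2 < p by lra.
  by have := strictly_convex_lt h h' (lexx _) fp; have := p0_min ((p + p0) / 2); lra.
Qed.

Lemma strictly_convex_min_gt p : p != p0 -> f p0 < f p.
Proof.
move=> pp0; rewrite ltNge; apply: contra pp0 => /strictly_convex_min_unique ->.
by rewrite eqxx.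
Qed.

Lemma strictly_convex_incr p q : p0 <= p -> p < q -> f p < f q.
Proof.
move=> + pq; case: (ltgtP p0 p) pq => // [lt0|<-] pq _.
  exact: strictly_convex_lt lt0 pq (p0_min _) _ => //.
by apply: strictly_convex_min_gt; rewrite gt_eqF.
Qed.

End StrictConvexity.

(** * Superlinear functions: minimum, values taken, Legendre transform *)

Section Superlinearity.
Variables (R : realType) (f : R -> R).
Hypothesis f_convex : strictly_convex f.
Hypothesis f_cont : continuous f.
Hypothesis f_superlinear : superlinear f.

Lemma superlinear_bound K : exists2 M, 0 < M & forall p, M <= `|p| -> K * `|p| <= f p.
Proof.
have [/cvgryPge/(_ K)[M1 [_ h1]] /cvgryPge/(_ K)[M2 [_ h2]]] := f_superlinear.
have m1 := ler_norm M1; have m2 := ler_norm (- M2); rewrite normrN in m2.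
have [n1 n2] := (normr_ge0 M1, normr_ge0 M2).
(* One threshold serves both ends; the extra 1 keeps [|p|] positive, so the quotient can be
   cleared. *)
exists (`|M1| + `|M2| + 1); first by lra.
move=> p Mp; have p0 : 0 < `|p| by lra.
rewrite -ler_pdivlMr //; case: (lerP 0 p) => [pge|plt].
  by apply: h1; rewrite (ger0_norm pge) in Mp; lra.
by apply: h2; rewrite (ltr0_norm plt) in Mp; lra.
Qed.

Lemma superlinear_min : exists p0, forall p, f p0 <= f p.
Proof.
have [M M0 hM] := superlinear_bound (`|f 0| / 1).
(* Outside [[-B, B]] one has [|p| > 1], hence [f p >= |f 0| * |p| >= f 0]. *)
pose B := M + 1.
have BB : - B <= B by rewrite /B; lra.
have [c cB cmin] := EVT_min BB (continuous_subspaceT f_cont).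
have c0 : f c <= f 0 by apply: cmin; rewrite in_itv /= /B; lra.
exists c => p; case: (lerP `|p| B) => [|Bp].
  by rewrite ler_norml => pB; apply: cmin; rewrite in_itv.
apply: le_trans c0 _; apply: le_trans (hM p _); last by rewrite /B in Bp; lra.
have := ler_norm (f 0); have := normr_ge0 (f 0); rewrite /B in Bp; nra.
Qed.

Lemma superlinear_sublevel_max p0 a : f p0 <= a -> exists2 p, p0 <= p & f p = a.
Proof.
move=> p0a; have [M M0 hM] := superlinear_bound 1.
(* Beyond [M] the function dominates the identity, so [f q >= q >= a]. *)
pose q := `|p0| + `|a| + M.
have h1 := ler_norm p0; have h2 := ler_norm a; have h3 := normr_ge0 p0.
have h4 := normr_ge0 a; have q0 : 0 <= q by rewrite /q; lra.
have p0q : p0 <= q by rewrite /q; lra.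
have aq : a <= f q.
  have := hM q; rewrite (ger0_norm q0) mul1r => h.
  by apply: le_trans (h _); rewrite /q; lra.
have [|p] := @IVT R f p0 q a p0q (continuous_subspaceT f_cont).
  by rewrite ge_min p0a le_max aq orbT.
by rewrite in_itv /= => /andP[p0p _] <-; exists p.
Qed.

Lemma superlinear_has_legendre q : has_sup [set p * q - f p | p in [set: R]].
Proof.
split; first by exists (0 * q - f 0), 0.
have [p0 p0_min] := superlinear_min.
have [M M0 hM] := superlinear_bound `|q|.
(* For [|p| >= M] the choice of slope [|q|] makes [p * q - f p] nonpositive; for smaller [|p|],
   [f p] is at least [f p0]. *)
exists (M * `|q| + `|f p0|) => _ [p _ <-].
have := ler_norm (p * q); rewrite normrM.
have := normr_ge0 (f p0); have := ler_norm (- f p0); rewrite normrN.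
have := normr_ge0 p; have := normr_ge0 q.
case: (lerP M `|p|) => [/hM|]; first by nra.
by have := p0_min p; nra.
Qed.

End Superlinearity.

(** * Convex duality for the Hamiltonian *)

Section Hamiltonian.
Variables (R : realType) (G : graph) (H : hamiltonian R G).
Implicit Types (e : edge G) (p q a : R).

Lemma ham_continuous e : continuous (H e).
Proof.
by move=> p; apply/differentiable_continuous/derivable1_diffP/ham_derivable.
Qed.

Lemma minimizerP e p : H e (minimizer H e) <= H e p.
Proof.
have [p0 p0_min] := superlinear_min (@ham_continuous e) (@ham_superlinear _ _ H e).
by rewrite /minimizer; case: xgetP => [_ _ /(_ p)//|/(_ p0)]; case.
Qed.

Lemma minimizer_unique e p : H e p <= H e (minimizer H e) -> p = minimizer H e.
Proof.
exact: (strictly_convex_min_unique (@ham_strictly_convex _ _ H e) (minimizerP e)).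
Qed.

Lemma ham_erev e p : H (erev e) p = H e (- p).
Proof. by rewrite (ham_rev H e) opprK. Qed.

Lemma minimizer_rev e : minimizer H (erev e) = - minimizer H e.
Proof.
by apply/esym/minimizer_unique; rewrite !ham_erev opprK minimizerP.
Qed.

Lemma ham_min_rev e : H (erev e) (minimizer H (erev e)) = H e (minimizer H e).
Proof. by rewrite minimizer_rev ham_erev opprK. Qed.

Lemma sigmaP e a : H e (minimizer H e) <= a ->
  minimizer H e <= sigma H e a /\ H e (sigma H e a) = a.
Proof.
move=> a_ge; rewrite /sigma; case: xgetP => [_ _ //|].
have [p ? ?] := superlinear_sublevel_max (@ham_continuous e)
  (@ham_superlinear _ _ H e) a_ge.
by move=> /(_ p); case.
Qed.

Lemma ham_incr e p p' : minimizer H e <= p -> p < p' -> H e p < H e p'.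
Proof.
exact: (strictly_convex_incr (@ham_strictly_convex _ _ H e) (minimizerP e)).
Qed.

(** Identifies the value chosen by [xget], by strict monotonicity to the right of the minimizer. *)
Lemma sigma_unique e a p : minimizer H e <= p -> H e p = a -> p = sigma H e a.
Proof.
move=> p_ge <-; have [s_ge sE] := sigmaP (minimizerP e p).
case: (ltgtP p (sigma H e (H e p))) => // lt0.
  by have := ham_incr p_ge lt0; rewrite sE ltxx.
by have := ham_incr s_ge lt0; rewrite sE ltxx.
Qed.

Lemma le_sigma e a p : H e p <= a -> p <= sigma H e a.
Proof.
move=> pa; have [s_ge sE] := sigmaP (le_trans (minimizerP e p) pa).
by rewrite leNgt; apply/negP => /(ham_incr s_ge); rewrite sE; lra.
Qed.

(** The decreasing branch of [H e] is inverted by minus the [sigma] of the reversed edge, so each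
    sublevel of [H e] is the interval between [- sigma H (erev e) a] and [sigma H e a]. *)
Lemma ham_sigma_rev e a : H e (minimizer H e) <= a ->
  H e (- sigma H (erev e) a) = a.
Proof. by rewrite -ham_min_rev => /sigmaP[_]; rewrite ham_erev. Qed.

Lemma ham_le e a p : H e (minimizer H e) <= a ->
  - sigma H (erev e) a <= p <= sigma H e a -> H e p <= a.
Proof.
move=> a_ge /andP[]; have := ham_sigma_rev a_ge; have [_] := sigmaP a_ge.
move=> sE s'E; rewrite le_eqVlt => /predU1P[<- _|lt1]; first by rewrite s'E.
rewrite le_eqVlt => /predU1P[->|lt2]; first by rewrite sE.
apply: ltW; apply: (strictly_convex_lt (@ham_strictly_convex _ _ H e) lt1 lt2).
  by rewrite s'E.
by rewrite sE.
Qed.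

Lemma ham_lt e a p : H e (minimizer H e) <= a ->
  - sigma H (erev e) a < p < sigma H e a -> H e p < a.
Proof.
move=> a_ge /andP[lt1 lt2].
apply: (strictly_convex_lt (@ham_strictly_convex _ _ H e) lt1 lt2).
  by rewrite ham_sigma_rev.
by have [_ ->] := sigmaP a_ge.
Qed.

Lemma sigma_minimizer e : sigma H e (H e (minimizer H e)) = minimizer H e.
Proof. by apply/esym/sigma_unique. Qed.

Lemma fenchel e p q : p * q - H e p <= lagrangian H e q.
Proof.
have := superlinear_has_legendre (@ham_continuous e) (@ham_superlinear _ _ H e) q.
by move=> hs; apply: (ub_le_sup hs.2); exists p.
Qed.

Lemma lagrangian_le e q a : (forall p, p * q - H e p <= a) -> lagrangian H e q <= a.
Proof.
move=> h; apply: ge_sup; first by exists (0 * q - H e 0), 0.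
by move=> _ [p _ <-].
Qed.

Lemma lagrangian0 e : lagrangian H e 0 = - H e (minimizer H e).
Proof.
apply/eqP; rewrite eq_le; apply/andP; split.
  by apply: lagrangian_le => p; have := minimizerP e p; lra.
by have := fenchel e (minimizer H e) 0; lra.
Qed.

(** The dual speed [q] is a subgradient of [H e] at [sigma H e a]; tested at the minimizer, the
    subgradient inequality makes it positive above the minimum level. At the minimum level,
    [q = 0]. *)
Lemma fenchel_sigma e a : H e (minimizer H e) <= a ->
  exists q, [/\ 0 <= q, lagrangian H e q = sigma H e a * q - a &
    H e (minimizer H e) < a -> 0 < q].
Proof.
rewrite le_eqVlt => /predU1P[<-|lt_a].
  by exists 0; rewrite sigma_minimizer lagrangian0; split => //; lra.
have [s_ge sE] := sigmaP (ltW lt_a).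
have [q hq] := strictly_convex_subgradient (@ham_strictly_convex _ _ H e) (sigma H e a).
rewrite sE in hq; have q0 : 0 < q by have := hq (minimizer H e); nra.
exists q; split => //; first exact: ltW.
apply/eqP; rewrite eq_le; apply/andP; split.
  by apply: lagrangian_le => p; have := hq p; lra.
by have := fenchel e (sigma H e a) q; rewrite sE.
Qed.

(** A nonnegative speed puts [p] on the increasing branch: to the left of the minimizer, Fenchel's
    inequality at the minimizer would contradict equality at [p]. *)
Lemma fenchel_eq_sigma e p q : 0 <= q -> lagrangian H e q <= p * q - H e p ->
  p = sigma H e (H e p).
Proof.
move=> q0 hL; apply: sigma_unique => //.
have h := fenchel e (minimizer H e) q; rewrite leNgt; apply/negP => lt0.
suff : H e (minimizer H e) < H e p by nra.
apply: (strictly_convex_min_gt (@ham_strictly_convex _ _ H e) (minimizerP e)).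
by rewrite lt_eqF.
Qed.

Lemma fenchel_eq_minimizer e p : lagrangian H e 0 <= - H e p -> p = minimizer H e.
Proof. by rewrite lagrangian0 => ?; apply: minimizer_unique; lra. Qed.

End Hamiltonian.

(** * Potentials and the critical level *)

Lemma finite_positive_lower_bound (R : realType) (I : finType) (F : I -> R) :
  (forall i, 0 < F i) -> exists2 eps, 0 < eps & forall i, eps <= F i.
Proof.
(* The default value 1 covers an empty index type. *)
move=> F0; exists (\big[Order.min/1]_i F i).
  by apply/bigmin_gtP.
by move=> i; apply/bigmin_leP; right; exists i.
Qed.

Lemma not_uniq_split (T : eqType) (s : seq T) : ~~ uniq s ->
  exists x s1 s2 s3, s = s1 ++ (x :: s2) ++ x :: s3.
Proof.
elim: s => //= x s IH; rewrite negb_and negbK => /orP[/splitPr[s2 s3]|/IH].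
  by exists x, [::], s2, s3.
by move=> [y [s1 [s2 [s3 ->]]]]; exists y, (x :: s1), s2, s3.
Qed.

Section Potential.
Variables (R : realType) (G : graph) (W : edge G -> R).

Lemma cycle_split (x : edge G) s1 s2 s3 :
  is_cycle (s1 ++ (x :: s2) ++ x :: s3) ->
  is_cycle (x :: s2) /\ is_cycle (x :: s3 ++ s1).
Proof.
rewrite /is_cycle -(rot_cycle (size s1)) rot_size_cat -catA /=.
by rewrite rcons_cat /= cat_path /= => /and3P[p1 p2 p3]; rewrite rcons_path p1.
Qed.

(** Induction on the length: a repeated edge cuts the cycle into two shorter cycles whose weights
    add up. Simple means without repeated edges here. *)
Lemma simple_cycles_ge0 :
  (forall xi, uniq xi -> is_cycle xi -> 0 <= \sum_(e <- xi) W e) ->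
  forall xi, is_cycle xi -> 0 <= \sum_(e <- xi) W e.
Proof.
move=> simple xi; have [n] := ubnP (size xi).
elim: n xi => // n IH xi le_n cyc.
have [/simple ->//|/not_uniq_split[x [s1 [s2 [s3 xiE]]]]] := boolP (uniq xi).
rewrite xiE in cyc le_n *; have [cyc1 cyc2] := cycle_split cyc.
have -> : \sum_(e <- s1 ++ (x :: s2) ++ x :: s3) W e =
    \sum_(e <- x :: s2) W e + \sum_(e <- x :: s3 ++ s1) W e.
  by rewrite !big_cat /= !big_cons !big_cat /=; ring.
rewrite !size_cat /= in le_n.
by apply: addr_ge0; apply: IH => //=; rewrite ?size_cat; lia.
Qed.

Hypothesis W_cycle : forall xi, is_cycle xi -> 0 <= \sum_(e <- xi) W e.

(** Between two occurrences of an edge lies a cycle, whose removal does not increase the weight; a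
    walk without repetition uses each edge at most once. *)
Lemma walk_lower_bound (s : seq (edge G)) :
  sorted (@follows G) s -> - \sum_e `|W e| <= \sum_(e <- s) W e.
Proof.
have [n] := ubnP (size s); elim: n s => // n IH s le_n ws.
have [us|/not_uniq_split[x [s1 [s2 [s3 sE]]]]] := boolP (uniq s).
  rewrite (big_uniq _ us) /= (bigID (mem s)) /= opprD.
  apply: (@le_trans _ _ (- \sum_(e in s) `|W e|)).
    by rewrite gerDl oppr_le0 sumr_ge0.
  rewrite -sumrN ler_sum // => e _; by have := ler_norm (- W e); rewrite normrN; lra.
rewrite sE in ws le_n *.
have [cyc ws'] : is_cycle (x :: s2) /\ sorted (@follows G) (s1 ++ x :: s3).
  case: s1 {sE le_n} ws => [|y s1]; rewrite /is_cycle /= !cat_path /=.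
    by move=> /and3P[p1 p2 p3]; rewrite rcons_path p1.
  by rewrite cat_path /= => /and5P[p1 p2 p3 p4 p5]; rewrite rcons_path p1 p2 p3.
have -> : \sum_(e <- s1 ++ (x :: s2) ++ x :: s3) W e =
    \sum_(e <- x :: s2) W e + \sum_(e <- s1 ++ x :: s3) W e.
  by rewrite !big_cat /= !big_cons; ring.
rewrite -[X in X <= _]add0r; apply: lerD (W_cycle cyc) (IH _ _ ws').
by move: le_n; rewrite !size_cat /= ; lia.
Qed.

(* Bellman's potential: the infimum of the weights of the walks ending at [x],
   the empty walk included, which is finite since loops can be cut out. *)
Lemma potential_exists :
  exists u : vertex G -> R, forall e, u (term e) - u (orig e) <= W e.
Proof.
pose walks x : set (seq (edge G)) := [set s | s = [::] \/
  exists e s', [/\ s = e :: s', path (@follows G) e s' & term (last e s') = x]].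
pose S x := [set \sum_(e <- s) W e | s in walks x].
have S0 x : S x !=set0 by exists 0, [::]; [left|rewrite big_nil].
have lbS x : has_lbound (S x).
  exists (- \sum_e `|W e|) => _ [s ws <-]; apply: walk_lower_bound.
  by case: ws => [->|[e [s' [-> ? _]]]].
exists (fun x => inf (S x)) => e; rewrite lerBlDr -lerBlDl.
apply: lb_le_inf => // _ [s ws <-]; rewrite lerBlDl addrC.
(* Appending [e] to a walk that ends at its origin gives a walk that ends at its terminus. *)
have <- : \sum_(f <- rcons s e) W f = \sum_(f <- s) W f + W e.
  by rewrite -cats1 big_cat big_seq1.
apply: (ge_inf (lbS _)); exists (rcons s e) => //; right.
case: ws => [->|[f [s' [-> ps' s'e]]]]; first by exists e, [::].
by exists f, (rcons s' e); rewrite rcons_path ps' last_rcons /follows s'e eqxx.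
Qed.

End Potential.

(** * Subsolutions and the weights of cycles at the critical level *)

Section CriticalLevel.
Variables (R : realType) (G : graph) (H : hamiltonian R G) (w : cochain1 R G).
Local Notation crit := (critical_value_cochain H w).
Local Notation levels := [set a | exists u, subsolution H w a u].

Lemma subsolutionE a u :
  subsolution H w a u <-> forall e, H e (w e + differential u e) <= a.
Proof.
split=> [su e|su x e _]; last by rewrite /ham_cochain addrC.
by have := su _ e erefl; rewrite /ham_cochain addrC.
Qed.

Lemma subsolution_min a u e : subsolution H w a u -> H e (minimizer H e) <= a.
Proof. by move=> /subsolutionE/(_ e); apply: le_trans; exact: minimizerP. Qed.

(** The upper bound at [erev e] is the lower bound at [e], since cochains change sign; the two
    together describe the sublevel interval of [H e]. *)
Lemma subsolution_sigma a u : (forall e, H e (minimizer H e) <= a) ->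
  subsolution H w a u <->
  forall e, u (term e) - u (orig e) <= sigma_cochain H w e a.
Proof.
move=> a_ge; split => [/subsolutionE su e|su].
  by have /le_sigma := su e; rewrite ffunE /sigma_cochain; lra.
apply/subsolutionE => e; apply: ham_le => //.
have := su e; have := su (erev e); rewrite /sigma_cochain cochain1_rev.
by rewrite ffunE /term Defs.revK; lra.
Qed.

Lemma levels_has_inf : has_inf levels.
Proof.
split.
  exists (\sum_e `|H e (w e)|), (fun=> 0); apply/subsolutionE => e.
  rewrite ffunE subrr addr0 (bigD1 e) //=; have := ler_norm (H e (w e)).
  suff : 0 <= \sum_(i | i != e) `|H i (w i)| by lra.
  exact: sumr_ge0.
have [e _] := card_gt0P (edge_gt0 G).
by exists (H e (minimizer H e)) => a [u /subsolution_min]; apply.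
Qed.

Lemma critical_ge_min e : H e (minimizer H e) <= crit.
Proof.
by apply: lb_le_inf; [exact: levels_has_inf.1|move=> a [u /subsolution_min]; apply].
Qed.

Lemma critical_le a u : subsolution H w a u -> crit <= a.
Proof. by move=> su; apply: (ge_inf levels_has_inf.2); exists u. Qed.

(** The infimum defining [crit] is not yet known to be attained, so subsolutions at nearby levels
    are used: their differentials sum to 0 along a cycle and exceed [sigma_cochain] by at most a
    small [d] on each edge. *)
Lemma sigma_path_critical_ge0 xi : is_cycle xi -> 0 <= sigma_path H w xi crit.
Proof.
move=> cyc; apply/ler_addgt0Pl => eps eps0.
pose d := eps / (size xi).+1%:R.
have d0 : 0 < d by rewrite divr_gt0 // ltr0n.
(* [F e] is the rise of [H e] when its argument passes [sigma] by [d]; a level within the least rise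
   [r] of [crit] keeps every argument below [sigma + d]. *)
pose F e := H e (sigma H e crit + d) - crit.
have F0 e : 0 < F e.
  have [s_ge sE] := sigmaP (critical_ge_min e).
  by rewrite subr_gt0 -{1}sE; apply: ham_incr => //; lra.
have [r r0 rF] := finite_positive_lower_bound F0.
have [a [u /subsolutionE su] a_lt] : exists2 a, levels a & a < crit + r.
  exact: inf_adherent levels_has_inf.
have du e : differential u e <= sigma_cochain H w e crit + d.
  have [s_ge sE] := sigmaP (critical_ge_min e).
  suff : w e + differential u e <= sigma H e crit + d by rewrite /sigma_cochain; lra.
  rewrite leNgt; apply/negP => lt_sum.
  have s_le : minimizer H e <= sigma H e crit + d by lra.
  by have := ham_incr s_le lt_sum; have := su e; have := rF e; rewrite /F; lra.
have : \sum_(e <- xi) differential u e <= \sum_(e <- xi) (sigma_cochain H w e crit + d).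
  by apply: ler_sum => e _; exact: du.
rewrite sum_differential_cycle // big_split /= big_const_seq count_predT iter_addr_0.
rewrite -/(sigma_path H w xi crit) => h; apply: le_trans h _.
rewrite addrC lerD2r /d -[_ *+ size xi]mulr_natr mulrAC ler_pdivrMr ?ltr0n //.
by rewrite ler_pM2l // ler_nat.
Qed.

(** Nonnegative cycle weights yield a potential, so the infimum defining [crit] is attained. *)
Lemma critical_subsolution : exists u, subsolution H w crit u.
Proof.
have [u hu] := potential_exists sigma_path_critical_ge0.
by exists u; apply/subsolution_sigma => // e; exact: critical_ge_min.
Qed.

(* Otherwise the weights [sigma_cochain H w e crit - d] still admit a potential
   for some [d > 0], which is a subsolution at a level below [crit]. *)
Lemma critical_cycle :
  exists xi, [/\ xi != [::], uniq xi, is_cycle xi & sigma_path H w xi crit <= 0].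
Proof.
apply: contrapT => nocycle.
have pos xi : xi != [::] -> uniq xi -> is_cycle xi -> 0 < sigma_path H w xi crit.
  by move=> *; rewrite ltNge; apply/negP => ?; apply: nocycle; exists xi.
(* The weight of a cycle without repeated edges depends only on its edge set, so finitely many
   values occur; 1 stands in for the nonpositive ones. *)
pose S (A : {set edge G}) := \sum_(e in A) sigma_cochain H w e crit.
have S0 (A : {set edge G}) : 0 < if 0 < S A then S A else 1 by case: ifP.
have [eps eps0 epsS] := finite_positive_lower_bound S0.
(* Such a cycle has at most [#|edge G|] edges, so it loses at most [eps] in all. *)
pose d := eps / #|edge G|.+1%:R.
have d0 : 0 < d by rewrite divr_gt0 // ltr0n.
pose W e := sigma_cochain H w e crit - d.
have Wcyc xi : uniq xi -> is_cycle xi -> 0 <= \sum_(e <- xi) W e.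
  move=> uxi cyc; have [->|xi0] := eqVneq xi [::]; first by rewrite big_nil.
  rewrite /W sumrB big_const_seq count_predT iter_addr_0 subr_ge0.
  have SE : sigma_path H w xi crit = S [set e in xi].
    by rewrite /sigma_path (big_uniq _ uxi) /S; apply: eq_bigl => e; rewrite inE.
  rewrite -/(sigma_path H w xi crit); have := epsS [set e in xi].
  rewrite -SE pos //; apply: le_trans.
  rewrite /d -[_ *+ size xi]mulr_natr mulrAC ler_pdivrMr ?ltr0n // ler_pM2l // ler_nat.
  by rewrite -(card_uniqP uxi) (leq_trans (max_card _)).
have [u hu] := potential_exists (simple_cycles_ge0 Wcyc).
(* The margin [d] places the momentum strictly inside the sublevel interval. *)
have F0 e : 0 < crit - H e (w e + differential u e).
  rewrite subr_gt0; apply: ham_lt; first exact: critical_ge_min.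
  have := hu e; have := hu (erev e); rewrite /W /sigma_cochain cochain1_rev.
  by rewrite ffunE /term Defs.revK; lra.
have [r r0 rF] := finite_positive_lower_bound F0.
have /critical_le : subsolution H w (crit - r) u.
  by apply/subsolutionE => e; have := rF e; lra.
by lra.
Qed.

(** Both edges have minimum level [crit], so their [sigma] are opposite minimizers; [w] cancels as
    well. *)
Lemma critical_eq_min_rev e : H e (minimizer H e) = crit ->
  sigma_path H w [:: e; erev e] crit = 0.
Proof.
move=> eE; rewrite /sigma_path !big_cons big_nil /sigma_cochain cochain1_rev.
rewrite -{1}eE -eE sigma_minimizer -(ham_min_rev H e) sigma_minimizer.
by rewrite minimizer_rev; lra.
Qed.

End CriticalLevel.

(** * Functions and measures on the tangent bundle *)

Section TangentFunctions.
Variables (R : realType) (G : graph).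
Local Notation T := (tangent R G).
Implicit Types (x y : T) (e : edge G) (q : {nonneg R}) (th : cochain1 R G).

Lemma tangentE x : x = \pi_T (tedge x, (repr x).2).
Proof. by rewrite /tedge -surjective_pairing reprK. Qed.

Lemma repr_pi e q :
  repr (\pi_T (e, q)) = (e, q) \/ [/\ (repr (\pi_T (e, q))).1 = erev e,
    (repr (\pi_T (e, q))).2%:num = 0 & q%:num = 0].
Proof.
have : tangent_equiv (repr (\pi_T (e, q))) (e, q).
  by apply/(@eqmodP _ (tangent_equiv_rel R G)); rewrite reprK.
rewrite /tangent_equiv => /orP[/eqP|/and3P[/= /eqP h /eqP h1 /eqP h2]]; first by left.
by right; split=> //; rewrite [in RHS]h Defs.revK.
Qed.

Lemma speed_pi e q : speed (\pi_T (e, q)) = q%:num.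
Proof. by rewrite /speed; have [->|[_ -> ->]] := repr_pi e q. Qed.

Lemma tedge_pi e q : 0 < q%:num -> tedge (\pi_T (e, q)) = e.
Proof. by rewrite /tedge; have [->//|[_ _ ->]] := repr_pi e q; rewrite ltxx. Qed.

Lemma speed_ge0 x : 0 <= speed x.
Proof. by rewrite /speed. Qed.

(** A cochain read as a function on the tangent bundle; it vanishes at rest, hence is independent of
    the representative. *)
Definition momentum th x : R := speed x * th (tedge x).

Lemma momentum_pi th e q : momentum th (\pi_T (e, q)) = q%:num * th e.
Proof.
rewrite /momentum speed_pi; have [q0|q0] := ltP 0 q%:num; first by rewrite tedge_pi.
have -> : q%:num = 0 by apply/eqP; rewrite eq_le q0 /=.
by rewrite !mul0r.
Qed.

Lemma half_lineP e x :
  half_line e x <-> tedge x = e \/ (tedge x = erev e /\ speed x = 0).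
Proof.
split=> [[q _ <-]|[<-|[xe x0]]].
- by rewrite speed_pi /tedge; have [->|[-> _ ->]] := repr_pi e q; [left|right].
- by exists (repr x).2 => //; rewrite -tangentE.
exists 0%:nng => //; rewrite [RHS]tangentE xe.
apply/(@eqmodP _ (tangent_equiv_rel R G)); rewrite /= /tangent_equiv /=.
by rewrite eqxx /= -/(speed x) x0 eqxx orbT.
Qed.

(** Points on lines that are neither equal nor opposite are at distance at least 1. *)
Lemma tdist_lt1 x y : tdist x y < 1 ->
  (tedge x = tedge y /\ tdist x y = `|speed x - speed y|) \/
  (tedge x = erev (tedge y) /\ tdist x y = speed x + speed y).
Proof.
rewrite /tdist /predist -/(tedge x) -/(tedge y) -/(speed x) -/(speed y).
case: eqP => [->|_]; first by left.
by case: eqP => [->|_]; [right|have := speed_ge0 x; have := speed_ge0 y; lra].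
Qed.

(* The bound is only required at small distances, so that a function which is
   constant on each edge may jump between distinct edges. *)
Lemma locally_lipschitz_continuous (f : T -> R) K :
  (forall x y, tdist x y < 1 -> `|f x - f y| <= K * tdist x y) -> continuous f.
Proof.
move=> fK x; apply/(@cvgrPdist_lt _ _ _ _ (@nbhs_filter T x)) => eps eps0.
pose d := Num.min 1 (eps / (`|K| + 1)).
have K1 : 0 < `|K| + 1 by have := normr_ge0 K; lra.
have d0 : 0 < d by rewrite lt_min ltr01 divr_gt0.
apply/nbhs_ballP; exists d => //= y; rewrite ballEmdist /= /d lt_min => /andP[xy1].
rewrite ltr_pdivlMr // => xyd; apply: le_lt_trans (fK _ _ xy1) _.
change (mdist x y) with (tdist x y) in *.
have := ler_norm K; have : 0 <= tdist x y by exact: (mdist_ge0 x y).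
by nra.
Qed.

Lemma speed_continuous : continuous (@speed R G).
Proof.
apply: (@locally_lipschitz_continuous _ 1) => x y /tdist_lt1[[_ ->]|[_ ->]].
  by rewrite mul1r.
by rewrite mul1r ler_norml; have := speed_ge0 x; have := speed_ge0 y; lra.
Qed.

Lemma cochain_bound th e : `|th e| <= \sum_f `|th f|.
Proof. by rewrite (bigD1 e) //= lerDl sumr_ge0. Qed.

(** Across a rest point, antisymmetry turns the difference of speeds into their sum, which is the
    distance. *)
Lemma momentum_lipschitz th x y : tdist x y < 1 ->
  `|momentum th x - momentum th y| <= (\sum_f `|th f|) * tdist x y.
Proof.
move=> /tdist_lt1[[exy ->]|[exy ->]]; rewrite /momentum exy.
  by rewrite -mulrBl normrM [leLHS]mulrC ler_wpM2r // cochain_bound.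
rewrite cochain1_rev mulrN -opprD normrN -mulrDl normrM [leLHS]mulrC.
have xy0 : 0 <= speed x + speed y by rewrite addr_ge0 ?speed_ge0.
by rewrite (ger0_norm xy0) ler_wpM2r // cochain_bound.
Qed.

Lemma momentum_continuous th : continuous (momentum th).
Proof. exact: (locally_lipschitz_continuous (@momentum_lipschitz th)). Qed.

(** Elementary cochain carried by [e] and its reverse: it realizes any momentum on a single edge. *)
Definition edge_cochain_val e (p : R) : {ffun edge G -> R} :=
  [ffun f => if f == e then p else if f == erev e then - p else 0].

Lemma edge_cochain_subproof e p :
  edge_cochain_val e p \in @antisymmetric_cochain R G.
Proof.
apply/forallP => f; rewrite !ffunE (inj_eq (inv_inj (@Defs.revK G))).
rewrite (can2_eq (@Defs.revK G) (@Defs.revK G)).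
have [->|fe] := eqVneq f e; last by case: ifP => _; rewrite ?opprK ?oppr0.
by rewrite -[e == _]eq_sym (negbTE (rev_neq e)).
Qed.

Definition edge_cochain e p : cochain1 R G := Cochain1 (edge_cochain_subproof e p).

Lemma edge_cochainE e p : edge_cochain e p e = p.
Proof. by rewrite ffunE eqxx. Qed.

(** The half-line without its rest point, written through a continuous function so that openness is
    immediate. *)
Definition open_half_line e : set T := [set x | 0 < momentum (edge_cochain e 1) x].

Lemma open_half_line_open e : open (open_half_line e).
Proof.
apply: (@open_comp _ _ _ [set r : R | 0 < r]); last exact: open_gt.
by move=> x _; exact: momentum_continuous.
Qed.

Lemma open_half_lineE e x : open_half_line e x = (0 < speed x) && (tedge x == e) :> Prop.
Proof.
rewrite /open_half_line /=; congr is_true.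
rewrite /momentum; have := speed_ge0 x; rewrite le_eqVlt => /predU1P[<-|x0].
  by rewrite mul0r ltxx.
rewrite pmulr_rgt0 // x0 /= ffunE; case: eqP => _; first exact: ltr01.
by case: eqP => _; rewrite ?ltr0N1 ?ltxx //; lra.
Qed.

Variable H : hamiltonian R G.

Lemma tangent_lagrangian_pi e q :
  tangent_lagrangian H (\pi_T (e, q)) = lagrangian H e q%:num.
Proof.
have := lagrangian_cochain_pi H 0 e q.
by rewrite /lagrangian_cochain !ffunE !mulr0 !subr0.
Qed.

Lemma tangent_fenchel th x :
  momentum th x - H (tedge x) (th (tedge x)) <= tangent_lagrangian H x.
Proof. by rewrite /momentum mulrC; exact: fenchel. Qed.

(** The Hamiltonian term agrees on [e] and [erev e], hence is locally constant. *)
Lemma fenchel_continuous th :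
  continuous (fun x => momentum th x - H (tedge x) (th (tedge x))).
Proof.
apply: (@locally_lipschitz_continuous _ (\sum_f `|th f|)) => x y xy1.
rewrite (_ : H (tedge x) _ = H (tedge y) (th (tedge y))).
  by rewrite opprB addrA subrK; exact: momentum_lipschitz.
have [[-> _ //]|[-> _]] := tdist_lt1 xy1.
by rewrite ham_erev cochain1_rev opprK.
Qed.

(* The Lagrangian is a supremum of continuous functions. *)
Lemma tangent_lagrangian_lsc (f : T -> R) a : continuous f ->
  open [set x | a < tangent_lagrangian H x + f x].
Proof.
move=> fc; pose g th x := momentum th x - H (tedge x) (th (tedge x)) + f x.
rewrite (_ : [set x | _] = \bigcup_(th in [set: cochain1 R G]) (g th @^-1` [set r | a < r])).
  apply: bigcup_open => th _; apply: open_comp; last exact: open_gt.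
  move=> x _; apply: cvgD; [exact: (@nbhs_filter T x)|exact: fenchel_continuous|exact: fc].
apply/seteqP; split => x /=.
  move=> ax; have [p] : exists p, ~ (p * speed x - H (tedge x) p <= a - f x).
    apply: contrapT => /forallNP h.
    have : lagrangian H (tedge x) (speed x) <= a - f x.
      by apply: lagrangian_le => p; apply: contrapT; exact: h.
    by move: ax; rewrite /tangent_lagrangian; lra.
  move=> /negP; rewrite -ltNge => lt_p.
  exists (edge_cochain (tedge x) p) => //=.
  by rewrite /g /momentum edge_cochainE; lra.
by move=> [th _ /=]; rewrite /g; have := tangent_fenchel th x; lra.
Qed.

End TangentFunctions.

(** * Integrals of functions with an integrable minorant *)

Section IntegralLowerBound.
Local Open Scope ereal_scope.
Context d (T : measurableType d) (R : realType).
Variables (mu : {measure set T -> \bar R}) (f g : T -> \bar R).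
Hypotheses (mf : measurable_fun setT f) (g_int : mu.-integrable setT g).
Hypothesis gf : forall x, g x <= f x.

Let fp : \int[mu]_x g^\+ x <= \int[mu]_x f^\+ x.
Proof.
apply: ge0_le_integral => //.
- by apply: measurable_funepos; exact: measurable_int g_int.
- exact: measurable_funepos.
- by move=> x _; apply: (@funepos_le _ _ setT); rewrite ?inE.
Qed.

Let fn : \int[mu]_x f^\- x <= \int[mu]_x g^\- x.
Proof.
apply: ge0_le_integral => //.
- exact: measurable_funeneg.
- by apply: measurable_funeneg; exact: measurable_int g_int.
- by move=> x _; apply: (@funeneg_le _ _ setT); rewrite ?inE.
Qed.

Lemma integral_lower_bound : \int[mu]_x g x <= \int[mu]_x f x.
Proof. by rewrite integralE [leRHS]integralE leeB. Qed.

(** The minorant controls the negative part; finiteness of the integral then controls the positive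
    part. *)
Lemma integrable_lower_bound : \int[mu]_x f x < +oo -> mu.-integrable setT f.
Proof.
have fn_lty : \int[mu]_x f^\- x < +oo.
  by apply: le_lt_trans fn _; exact: integral_funeneg_lt_pinfty.
have fn_ge0 : 0 <= \int[mu]_x f^\- x by apply: integral_ge0.
rewrite integralE => f_lty; apply/integrableP; split => //.
rewrite (_ : (fun x => `|f x|) = f^\+ \+ f^\-); last first.
  by rewrite -fune_abse.
rewrite ge0_integralD //; [|exact: measurable_funepos|exact: measurable_funeneg].
apply: lte_add_pinfty => //; move: f_lty fn_lty fn_ge0.
case: (\int[mu]_x f^\+ x) => [r||]; case: (\int[mu]_x f^\- x) => [s||] //.
by move=> *; exact: ltry.
Qed.

End IntegralLowerBound.

(** * Borel measures on the tangent bundle and their rotation *)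

Section TangentMeasure.
Variables (R : realType) (G : graph).
Local Notation T := (tangent R G).
Local Notation B := (tborel R G).

Lemma open_tborel_measurable (U : set T) : open U -> measurable (U : set B).
Proof. by move=> oU; apply: sub_sigma_algebra. Qed.

Lemma lsc_tborel_measurable (f : T -> R) :
  (forall a, open [set x | a < f x]) -> measurable_fun [set: B] (f : B -> R).
Proof.
move=> fo; apply: (measurability _ (@RGenOInfty.measurableE R)).
move=> /= _ [_ [a ->] <-]; rewrite setTI; apply: open_tborel_measurable.
rewrite (_ : _ @^-1` _ = [set x | a < f x]); first exact: fo.
by apply/seteqP; split => x /=; rewrite in_itv /= andbT.
Qed.

Lemma continuous_tborel_measurable (f : T -> R) :
  continuous f -> measurable_fun [set: B] (f : B -> R).
Proof.
move=> fc; apply: lsc_tborel_measurable => a.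
rewrite (_ : [set x | a < f x] = f @^-1` [set r | a < r]) //.
by apply: open_comp; [move=> x _; exact: fc|exact: open_gt].
Qed.

Definition rest_point (e : edge G) : T := \pi_T (e, 0%:nng).

Lemma half_line_measurable (e : edge G) : measurable (half_line e : set B).
Proof.
pose z := rest_point e.
rewrite (_ : half_line e = @open_half_line R G e `|` [set z]).
  apply: measurableU; first exact: open_tborel_measurable (@open_half_line_open R G e).
  rewrite -[X in measurable X]setCK; apply: measurableC; apply: open_tborel_measurable.
  apply: closed_openC; apply: accessible_closed_set1; apply: hausdorff_accessible.
  exact: metric_hausdorff.
apply/seteqP; split => x; rewrite /setU /= open_half_lineE.
  move=> [q _ <-]; have [q0|q0] := ltP 0 q%:num.
    by left; rewrite speed_pi q0 tedge_pi // eqxx.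
  right; congr (\pi_T (_, _)); apply/val_inj/eqP => /=.
  by rewrite eq_le q0 /=.
by case=> [/andP[_ /eqP xe]|->]; [apply/half_lineP; left|exists 0%:nng].
Qed.

Variable mu : probability B R.
Hypothesis mu_moment : finite_moment mu.

Lemma speed_integrable : mu.-integrable setT (fun x => (speed x)%:E).
Proof.
apply/integrableP; split.
  by apply/measurable_EFinP; exact: continuous_tborel_measurable (@speed_continuous R G).
move: mu_moment; rewrite /finite_moment /=; congr (_ < _)%E.
by apply: eq_integral => x _; rewrite /= ger0_norm ?speed_ge0.
Qed.

Lemma momentum_measurable th : measurable_fun [set: B] (momentum th : B -> R).
Proof. exact: continuous_tborel_measurable (@momentum_continuous R G th). Qed.

Lemma momentum_integrable (th : cochain1 R G) :
  mu.-integrable setT (fun x => (momentum th x)%:E).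
Proof.
pose g (x : T) := ((\sum_f `|th f|)%:E * (speed x)%:E)%E.
have g_int : mu.-integrable setT g by exact: integrableZl speed_integrable.
apply: le_integrable g_int => //.
- by apply/measurable_EFinP; exact: momentum_measurable.
- move=> x _; rewrite /g -EFinM /= lee_fin /momentum mulrC !normrM.
  rewrite ler_wpM2r //; apply: le_trans (cochain_bound th _) _; exact: ler_norm.
Qed.

(** Half-lines meet only at rest points, where every term vanishes. Integrated, this finite sum is
    the pairing with the rotation. *)
Lemma momentum_half_lines (th : cochain1 R G) (x : T) :
  momentum th x = \sum_e (th e * (@speed R G \_ (half_line e)) x).
Proof.
have := speed_ge0 x; rewrite le_eqVlt => /predU1P[x0|x0].
  rewrite /momentum -x0 mul0r big1 // => e _; rewrite patchE.
  by case: ifP; rewrite -?x0 mulr0.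
rewrite (bigD1 (tedge x)) //= big1 ?addr0.
  have hx : half_line (tedge x) x by apply/half_lineP; left.
  by rewrite patchE (mem_set hx) mulrC.
move=> e ex; have hx : ~ half_line e x.
  case/half_lineP => [xe|[_ x0']]; first by rewrite xe eqxx in ex.
  by rewrite x0' ltxx in x0.
by rewrite patchE (memNset hx) mulr0.
Qed.

Lemma half_line_speed_integrable (e : edge G) :
  mu.-integrable setT (fun x => ((@speed R G \_ (half_line e)) x)%:E).
Proof.
have := (integrable_mkcond (mu := mu) (fun x => (speed x)%:E) (half_line_measurable e)).1.
rewrite restrict_EFin; apply.
exact: (integrableS measurableT (half_line_measurable e) _ speed_integrable).
Qed.

Lemma integral_half_line_speed (e : edge G) :
  (\int[mu]_x ((@speed R G \_ (half_line e)) x)%:E =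
   (\int[mu]_(x in half_line e) speed x)%:E)%E.
Proof.
rewrite /Rintegral fineK; last first.
  apply: integrable_fin_num; first exact: half_line_measurable.
  exact: (integrableS measurableT (half_line_measurable e) _ speed_integrable).
by rewrite [RHS]integral_mkcond restrict_EFin.
Qed.

Lemma integral_momentum (th : cochain1 R G) :
  (\int[mu]_x (momentum th x)%:E)%E = (cochain_integral th mu)%:E.
Proof.
under eq_integral => x _ do rewrite momentum_half_lines -sumEFin.
under eq_integral => x _ do under eq_bigr => e _ do rewrite EFinM.
rewrite integral_sum //; last first.
  by move=> e; exact: integrableZl (half_line_speed_integrable e).
rewrite /cochain_integral pairing_pi -sumEFin; apply: eq_bigr => e _.
rewrite integralZl //; last exact: half_line_speed_integrable.
by rewrite integral_half_line_speed ffunE mulrC EFinM.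
Qed.

(** The speed cut off to the half-line is nonnegative and nonzero exactly on the open half-line, so
    its integral vanishes iff that set is null. *)
Lemma half_line_flow_gt0 (e : edge G) :
  (0 < \int[mu]_(x in half_line e) speed x) =
  (mu (@open_half_line R G e) != 0%E).
Proof.
pose phi (x : T) : R := (@speed R G \_ (half_line e)) x.
have phi_ge0 x : 0 <= phi x by rewrite /phi patchE; case: ifP => // _; exact: speed_ge0.
have phi_gt0 x : open_half_line e x <-> phi x <> 0.
  rewrite open_half_lineE /phi; split.
    move=> /andP[x0 /eqP xe] phi0; have hx : half_line e x by apply/half_lineP; left.
    by move: phi0; rewrite patchE (mem_set hx) => x0'; rewrite x0' ltxx in x0.
  rewrite patchE; case: ifP => [/set_mem/half_lineP[xe|[_ ->]//]|] //.
  by move=> /eqP x0; rewrite xe eqxx andbT lt_neqAle eq_sym x0 speed_ge0.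
have mphi : measurable_fun [set: B] (fun x => (phi x)%:E).
  exact: measurable_int (half_line_speed_integrable e).
have absE : (\int[mu]_x `|(phi x)%:E| = (\int[mu]_(x in half_line e) speed x)%:E)%E.
  rewrite -integral_half_line_speed; apply: eq_integral => x _.
  by rewrite /= ger0_norm.
have flow_ge0 : 0 <= \int[mu]_(x in half_line e) speed x.
  by apply: Rintegral_ge0 => x _; exact: speed_ge0.
have mA : measurable (@open_half_line R G e : set B).
  exact: open_tborel_measurable (@open_half_line_open R G e).
have ae0 := ae_eq_integral_abs mu measurableT mphi.
rewrite lt_neqAle flow_ge0 andbT eq_sym; congr (~~ _); apply/eqP/eqP => [flow0|muA0].
  have : (\int[mu]_x `|(phi x)%:E| = 0)%E by rewrite absE flow0.
  move=> /ae0 phi0; apply: measure_negligible => //.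
  apply: negligibleS phi0 => x /phi_gt0 phix /= /(_ I) [] phi0; exact: phix.
apply: EFin_inj; rewrite -absE; apply/ae0.
exists (@open_half_line R G e); split => //.
by move=> x /= nphi; apply/phi_gt0 => phi0; apply: nphi => _; rewrite phi0.
Qed.

End TangentMeasure.

(** * Circulations on a graph *)

Section Circulation.
Variables (R : realType) (G : graph) (r : edge G -> R).
Hypothesis r_ge0 : forall e, 0 <= r e.
Hypothesis r_closed : forall f : vertex G -> R,
  \sum_e r e * (f (term e) - f (orig e)) = 0.

(* No mass leaves the set of vertices reached from [e] along edges of positive
   mass, hence by conservation none enters it, and [e] must start inside it. *)
Lemma circulation_cycle e : 0 < r e ->
  exists xi, [/\ is_cycle xi, e \in xi & forall f, f \in xi -> 0 < r f].
Proof.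
move=> re; pose next := [rel f g : edge G | follows f g && (0 < r g)].
pose S x := [exists f, connect next e f && (term f == x)].
pose ind x : R := (S x)%:R.
have flow_ge0 f : 0 <= r f * (ind (term f) - ind (orig f)).
  have := r_ge0 f; rewrite le_eqVlt => /predU1P[<-|rf]; first by rewrite mul0r.
  rewrite pmulr_rge0 // subr_ge0 /ind ler_nat.
  case: (boolP (S (orig f))) => // /existsP[g /andP[eg /eqP gf]].
  suff -> : S (term f) by [].
  apply/existsP; exists f; rewrite eqxx andbT; apply: connect_trans eg _.
  by apply: connect1; rewrite /= /follows gf eqxx.
(* Conservation tested on the indicator of the reached set: nonnegative terms with sum 0 all vanish,
   that of [e] included. *)
have /(_ e isT)/eqP := psumr_eq0P (fun f _ => flow_ge0 f) (r_closed ind).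
have Se : S (term e) by apply/existsP; exists e; rewrite connect0 eqxx.
rewrite mulf_eq0 gt_eqF //= /ind Se subr_eq0 => /eqP.
case: (boolP (S (orig e))) => [/existsP[f /andP[/connectP[s es ->] /eqP fe]] _|_].
  exists (e :: s); split; first 1 last.
  - exact: mem_head.
  - have path_pos e' t : path next e' t -> forall g, g \in t -> 0 < r g.
      elim: t e' => //= h t IH e' /andP[/andP[_ rh] ht] g.
      by rewrite inE => /predU1P[->//|]; exact: IH ht g.
    by move=> g; rewrite inE => /predU1P[->//|]; exact: path_pos es g.
  rewrite /is_cycle /= rcons_path /follows fe eqxx andbT.
  by apply: sub_path es => f' g' /andP[].
by move/eqP; rewrite oner_eq0.
Qed.

End Circulation.

(** * Finite convex combinations of Dirac masses *)

Section DiscreteMeasure.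
Context d (T : measurableType d) (R : realType).
Variables (n : nat) (m : nat -> {nonneg R}) (pt : nat -> T).
Hypothesis m_sum : \sum_(k < n) (m k)%:num = 1.

Let nu : set T -> \bar R := msum (fun k => mscale (m k) \d_(pt k)) n.

Let nuT : nu setT = 1%E.
Proof.
rewrite /nu /msum /= -m_sum -sumEFin; apply: eq_bigr => k _.
by rewrite /mscale /= diracE in_setT mule1.
Qed.

Lemma discrete_probability : exists mu : probability T R,
  [/\ forall f : T -> R, measurable_fun setT f ->
        (\int[mu]_x (f x)%:E = (\sum_(k < n) (m k)%:num * f (pt k))%:E)%E &
      forall k (U : set T), (k < n)%N -> 0 < (m k)%:num -> measurable U ->
        U (pt k) -> (0 < mu U)%E].
Proof.
pose mixin := Measure_isProbability.Build d T R
  (msum (fun k => mscale (m k) \d_(pt k)) n) nuT.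
pose mu : probability T R := HB.pack (msum (fun k => mscale (m k) \d_(pt k)) n) mixin.
exists mu; split=> [f mf|k U kn mk mU Uk]; last first.
  apply: (@lt_le_trans _ _ (mscale (m k) \d_(pt k) U)).
    by rewrite /mscale /= diracE (mem_set Uk) mule1 lte_fin.
  rewrite /mu /= /msum (bigD1 (Ordinal kn)) //= leeDl //.
  by apply: sume_ge0 => j _; rewrite measure_ge0.
have ge0 (g : T -> R) : measurable_fun setT g -> (forall x, 0 <= g x) ->
    (\int[mu]_x (g x)%:E = (\sum_(k < n) (m k)%:num * g (pt k))%:E)%E.
  move=> mg g0; have mg' : measurable_fun setT (EFin \o g) by exact/measurable_EFinP.
  rewrite (ge0_integral_measure_sum (fun k => mscale (m k) \d_(pt k))) //; last first.
    by move=> x _; rewrite lee_fin.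
  rewrite -sumEFin; apply: eq_bigr => k _.
  rewrite ge0_integral_mscale //; last by move=> x _; rewrite lee_fin.
  by rewrite integral_dirac // diracE in_setT mul1e -EFinM.
(* A signed [f] is reduced to its positive and negative parts. *)
rewrite integralE.
rewrite (eq_integral (fun x => (Num.max (f x) 0)%:E)); last first.
  by move=> x _; rewrite funeposE EFin_max.
rewrite [X in (_ - X)%E](eq_integral (fun x => (Num.max (- f x) 0)%:E)); last first.
  by move=> x _; rewrite funenegE EFin_max EFinN.
rewrite !ge0; try by move=> x; rewrite le_max lexx orbT.
- rewrite -EFinB -sumrB; congr EFin; apply: eq_bigr => k _; rewrite -mulrBr.
  by congr (_ * _); case: (lerP (f (pt k)) 0); case: (lerP (- f (pt k)) 0); lra.
- by apply: measurable_maxr => //; exact: measurableT_comp.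
- exact: measurable_maxr.
Qed.

End DiscreteMeasure.

(** * Minimizing measures *)

Section Mather.
Variables (R : realType) (G : graph) (H : hamiltonian R G).
Local Notation T := (tangent R G).
Local Notation B := (tborel R G).
Implicit Types (mu : probability B R) (w th : cochain1 R G) (c : cohomology1 R G).

Lemma pairingD w th (h : chain1 R G) : pairing (w + th) h = pairing w h + pairing th h.
Proof.
by rewrite /pairing -big_split; apply: eq_bigr => e _; rewrite ffunE mulrDr.
Qed.

(** The coefficient of the boundary at [x] is the closedness condition tested on the indicator of
    [x]. *)
Lemma rotation_homology mu : closed_measures mu -> homology1 (rotation mu).
Proof.
move=> [_ mu_closed]; rewrite /homology1 /= boundary_pi.
apply/ffunP => x; rewrite sum_ffunE [RHS]ffunE.
have := mu_closed (fun y => (x == y)%:R); rewrite /cochain_integral pairing_pi => sum0.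
by rewrite -[RHS]sum0; apply: eq_bigr => e _; rewrite !ffunE.
Qed.

Lemma tangent_lagrangian_measurable (f : T -> R) : continuous f ->
  measurable_fun [set: B] ((fun x => tangent_lagrangian H x + f x) : B -> R).
Proof. by move=> fc; apply: lsc_tborel_measurable => a; exact: tangent_lagrangian_lsc. Qed.

Lemma lagrangian_measurable :
  measurable_fun [set: B] (tangent_lagrangian H : B -> R).
Proof.
have := @tangent_lagrangian_measurable (fun=> 0).
rewrite (_ : (fun x => _ + _) = tangent_lagrangian H); last first.
  by apply/funext => x; rewrite addr0.
by apply; exact: cst_continuous.
Qed.

Section ClosedMeasure.
Variable mu : probability B R.
Hypothesis mu_closed : closed_measures mu.

Lemma cochain_integral_exact w u :
  cochain_integral (w + differential u) mu = cochain_integral w mu.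
Proof. by rewrite /cochain_integral pairingD [X in _ + X](mu_closed.2 u) addr0. Qed.

Lemma momentum_sub_integrable th a :
  mu.-integrable setT (fun x => (momentum th x - a)%:E).
Proof.
have := integrableB measurableT (momentum_integrable mu_closed.1 th)
  (finite_measure_integrable_cst mu a measurableT).
by apply.
Qed.

Lemma integral_momentum_sub th a :
  (\int[mu]_x (momentum th x - a)%:E = (cochain_integral th mu - a)%:E)%E.
Proof.
under eq_integral => x _ do rewrite EFinB.
rewrite integralB_EFin //; first last.
- exact: finite_measure_integrable_cst.
- exact: momentum_integrable mu_closed.1 th.
rewrite (integral_momentum mu_closed.1) EFinB; congr (_ - _)%E.
rewrite [LHS](integral_cst mu measurableT a%:E) -[RHS]mule1; congr (_ * _)%E.
exact: probability_setT.
Qed.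

Lemma subsolution_momentum w a u (x : T) : subsolution H w a u ->
  momentum (w + differential u) x - a <= tangent_lagrangian H x.
Proof.
move=> /subsolutionE/(_ (tedge x)); have := tangent_fenchel H (w + differential u) x.
by rewrite [(w + _) _]ffunE; lra.
Qed.

(** Integrates the pointwise Fenchel bound; the differential of [u] contributes 0 because [mu] is
    closed. *)
Lemma integral_lagrangian_ge w a u : subsolution H w a u ->
  ((cochain_integral w mu - a)%:E <= \int[mu]_x (tangent_lagrangian H x)%:E)%E.
Proof.
move=> su; rewrite -(cochain_integral_exact w u) -integral_momentum_sub.
apply: integral_lower_bound.
- by apply/measurable_EFinP; exact: lagrangian_measurable.
- exact: momentum_sub_integrable.
- by move=> x; rewrite lee_fin subsolution_momentum.
Qed.

Lemma alpha_ge c :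
  ((cochain_integral (repr c) mu)%:E - \int[mu]_x (tangent_lagrangian H x)%:E
    <= alpha H c)%E.
Proof.
apply: (@le_trans _ _ ((pairing_class c (rotation mu))%:E - beta H (rotation mu))%E).
  by apply: leeB => //; apply: ereal_inf_lbound; exists mu.
apply: ereal_sup_ubound; exists (rotation mu) => //; exact: rotation_homology.
Qed.

End ClosedMeasure.

Lemma alpha_le c a u : subsolution H (repr c) a u -> (alpha H c <= a%:E)%E.
Proof.
move=> su; apply: ge_ereal_sup => _ [h _ <-].
have : ((pairing_class c h - a)%:E <= beta H h)%E.
  apply: le_ereal_inf_tmp => _ [mu [mu_closed <-] <-].
  exact: integral_lagrangian_ge su.
(* At [+oo] the difference is [-oo]; the value [-oo] is excluded by the lower bound. *)
by case: (beta H h) => [b||] //=; rewrite -?EFinB ?lee_fin ?leNye //; lra.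
Qed.

(** Common source of the measures carried by cycles and of the Dirac masses at rest. *)
Lemma discrete_closed_measure n (m : nat -> {nonneg R}) (f : nat -> edge G)
    (q : nat -> {nonneg R}) :
  \sum_(k < n) (m k)%:num = 1 ->
  (forall g : vertex G -> R,
    \sum_(k < n) (m k)%:num * ((q k)%:num * differential g (f k)) = 0) ->
  exists mu, [/\ closed_measures mu,
    forall w, cochain_integral w mu =
      \sum_(k < n) (m k)%:num * ((q k)%:num * w (f k)),
    (\int[mu]_x (tangent_lagrangian H x)%:E =
      (\sum_(k < n) (m k)%:num * lagrangian H (f k) (q k)%:num)%:E)%E &
    forall k, (k < n)%N -> 0 < (m k)%:num -> msupport mu (\pi_T (f k, q k))].
Proof.
move=> m1 m_closed; pose pt k : B := \pi_T (f k, q k).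
have [mu [mu_int mu_supp]] := discrete_probability pt m1.
have mu_moment : finite_moment mu.
  rewrite /finite_moment /= mu_int ?ltry //.
  exact: continuous_tborel_measurable (@speed_continuous R G).
have mu_w w : cochain_integral w mu =
    \sum_(k < n) (m k)%:num * ((q k)%:num * w (f k)).
  apply: EFin_inj; rewrite -(integral_momentum mu_moment) mu_int; last first.
    exact: momentum_measurable.
  by congr EFin; apply: eq_bigr => k _; rewrite momentum_pi.
exists mu; split => //.
- by split=> // g; rewrite mu_w m_closed.
- rewrite mu_int; last exact: lagrangian_measurable.
  by congr EFin; apply: eq_bigr => k _; rewrite tangent_lagrangian_pi.
- by move=> k kn mk U oU Uk; apply: mu_supp kn mk _ Uk; exact: open_tborel_measurable.
Qed.

(* The mass of each edge is inversely proportional to its speed, so that the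
   rotation is a multiple of the cycle. *)
Lemma cycle_measure w a (xi : seq (edge G)) :
  (forall e, H e (minimizer H e) < a) -> xi != [::] -> is_cycle xi ->
  sigma_path H w xi a <= 0 ->
  exists mu, [/\ closed_measures mu,
    (\int[mu]_x (tangent_lagrangian H x)%:E <= (cochain_integral w mu - a)%:E)%E &
    forall e, e \in xi -> exists2 x : T, msupport mu x & edge_proj x e].
Proof.
move=> a_gt xi0 cyc xi_le.
have /choice[q hq] : forall e, exists q : {nonneg R},
    0 < q%:num /\ lagrangian H e q%:num = sigma H e a * q%:num - a.
  move=> e; have [q [q0 qL /(_ (a_gt e)) q_gt]] := fenchel_sigma (ltW (a_gt e)).
  by exists (NngNum q0).
have q_gt e : 0 < (q e)%:num by have [] := hq e.
pose Z := \sum_(e <- xi) (q e)%:num^-1.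
have e0 : edge G by case: xi xi0 {cyc xi_le Z}.
have Z0 : 0 < Z.
  rewrite /Z; case: xi xi0 {cyc xi_le Z} => // e s _; rewrite big_cons.
  by rewrite ltr_pwDl ?invr_gt0 // sumr_ge0 // => f _; rewrite invr_ge0.
have m0 e : 0 <= (q e)%:num^-1 / Z by rewrite divr_ge0 ?invr_ge0 // ltW.
pose m e := NngNum (m0 e).
have sum_xi (F : edge G -> R) :
    \sum_(k < size xi) F (nth e0 xi k) = \sum_(e <- xi) F e.
  by rewrite (big_nth e0) big_mkord.
have mq e x : (m e)%:num * ((q e)%:num * x) = Z^-1 * x.
  by have := q_gt e; rewrite /m /= => /lt0r_neq0 h; field; rewrite h gt_eqF.
have [||mu [mu_closed mu_w mu_L mu_supp]] := @discrete_closed_measure (size xi)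
    (m \o nth e0 xi) (nth e0 xi) (q \o nth e0 xi).
- by rewrite (sum_xi (fun e => (m e)%:num)) /= -mulr_suml divff // gt_eqF.
- move=> g; rewrite (eq_bigr (fun k : 'I__ => Z^-1 * differential g (nth e0 xi k))).
    by rewrite -mulr_sumr (sum_xi (differential g)) sum_differential_cycle ?mulr0.
  by move=> k _; exact: mq.
exists mu; split=> //.
- rewrite mu_L mu_w lee_fin.
  rewrite (sum_xi (fun e => (m e)%:num * lagrangian H e (q e)%:num)).
  rewrite (sum_xi (fun e => (m e)%:num * ((q e)%:num * w e))).
  (* With [a] spread over the atoms, the difference of the two sides is [Z^-1] times the
     [sigma_path] of the cycle. *)
  have Zm : \sum_(e <- xi) (m e)%:num * a = a.
    by rewrite -mulr_suml /= -mulr_suml divff ?mul1r // gt_eqF.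
  rewrite -[X in _ <= _ - X]Zm -subr_le0 -!sumrB.
  rewrite (eq_bigr (fun e => Z^-1 * sigma_cochain H w e a)).
    by rewrite -mulr_sumr pmulr_rle0 // invr_gt0.
  move=> e _; have [_ ->] := hq e; rewrite /sigma_cochain mulrBr -!(mq e); ring.
- move=> e /(nthP e0)[k kn <-]; exists (\pi_T (nth e0 xi k, q (nth e0 xi k))).
    by apply: mu_supp => //=; rewrite divr_gt0 ?invr_gt0.
  by rewrite /edge_proj speed_pi q_gt tedge_pi.
Qed.

Lemma rest_measure w e : exists mu, closed_measures mu /\
  (\int[mu]_x (tangent_lagrangian H x)%:E <=
    (cochain_integral w mu - H e (minimizer H e))%:E)%E.
Proof.
have [||mu [mu_closed mu_w mu_L _]] :=
    @discrete_closed_measure 1 (fun=> 1%:nng) (fun=> e) (fun=> 0%:nng).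
- by rewrite big_ord1.
- by move=> g; rewrite big_ord1 /= mul0r mulr0.
exists mu; split=> //; rewrite mu_L mu_w !big_ord1 /= mul0r mulr0 mul1r.
by rewrite lagrangian0 sub0r.
Qed.

(** * The identity of [alpha] with the critical value, and the Fenchel defect *)

Section Critical.
Variable c : cohomology1 R G.
Local Notation w := (repr c).
Local Notation crit := (critical_value_cochain H (repr c)).

Lemma minimal_measure : exists mu, closed_measures mu /\
  (\int[mu]_x (tangent_lagrangian H x)%:E <= (cochain_integral w mu - crit)%:E)%E.
Proof.
have [[e eE]|no_rest] := pselect (exists e, H e (minimizer H e) = crit).
  by rewrite -eE; exact: rest_measure.
have [xi [xi0 _ cyc xi_le]] := critical_cycle H w.
have [e|mu [? ? _]] := cycle_measure _ xi0 cyc xi_le; last by exists mu.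
rewrite lt_neqAle critical_ge_min andbT; apply/eqP => eE.
by apply: no_rest; exists e.
Qed.

Lemma alpha_critical : alpha H c = crit%:E.
Proof.
have [u su] := critical_subsolution H w.
apply/eqP; rewrite eq_le (alpha_le su) /=.
have [mu [mu_closed mu_le]] := minimal_measure.
apply: le_trans (alpha_ge mu_closed c).
have mu_ge := integral_lagrangian_ge mu_closed su.
have -> : (\int[mu]_x (tangent_lagrangian H x)%:E = (cochain_integral w mu - crit)%:E)%E.
  by apply/eqP; rewrite eq_le mu_le mu_ge.
by rewrite -EFinB lee_fin; lra.
Qed.

(** The reverse inequality always holds, so the hypothesis is an equality; the Lagrangian is then
    integrable and the action splits into two finite integrals. *)
Lemma minimizing_measure mu : closed_measures mu ->
  (\int[mu]_x (tangent_lagrangian H x)%:E <= (cochain_integral w mu - crit)%:E)%E ->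
  minimizing_measures H c mu.
Proof.
move=> mu_closed mu_le; split=> //; rewrite alpha_critical.
have [u su] := critical_subsolution H w.
have mu_ge := integral_lagrangian_ge mu_closed su.
have muE : (\int[mu]_x (tangent_lagrangian H x)%:E = (cochain_integral w mu - crit)%:E)%E.
  by apply/eqP; rewrite eq_le mu_le mu_ge.
rewrite /action /lagrangian_cochain; under eq_integral => x _ do rewrite EFinB.
rewrite integralB_EFin //.
- rewrite muE [X in (_ - X)%E](integral_momentum mu_closed.1) -EFinB -EFinN.
  by congr EFin; ring.
- apply: integrable_lower_bound.
  + by apply/measurable_EFinP; exact: lagrangian_measurable.
  + exact: (momentum_sub_integrable mu_closed (w + differential u) crit).
  + by move=> x; rewrite lee_fin subsolution_momentum.
  + by rewrite muE ltry.
- exact: momentum_integrable mu_closed.1 w.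
Qed.

(** The Fenchel defect at level [crit], grouped as the Lagrangian plus a continuous function so that
    semicontinuity applies. *)
Definition gap (u : vertex G -> R) (x : T) : R :=
  tangent_lagrangian H x + (crit - momentum (w + differential u) x).

Variable u : vertex G -> R.
Hypothesis u_sub : subsolution H w crit u.

Lemma gap_ge0 x : 0 <= gap u x.
Proof. by have := subsolution_momentum x u_sub; rewrite /gap; lra. Qed.

Lemma gap_continuous_part :
  continuous (fun x : T => crit - momentum (w + differential u) x).
Proof.
move=> x; apply: cvgB; first exact: (@nbhs_filter T x).
  exact: cst_continuous.
exact: momentum_continuous.
Qed.

Lemma gap_open : open [set x | 0 < gap u x].
Proof. exact: tangent_lagrangian_lsc gap_continuous_part. Qed.

(** A zero defect turns both Fenchel's inequality and the subsolution inequality into equalities. *)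
Lemma gap_eq0 x : gap u x = 0 ->
  differential u (tedge x) = sigma_cochain H w (tedge x) crit /\
  (speed x = 0 -> H (tedge x) (minimizer H (tedge x)) = crit).
Proof.
set e := tedge x; set p := w e + differential u e => gap0.
have LE : tangent_lagrangian H x = p * speed x - crit.
  move: gap0; rewrite /gap /momentum [(w + _) _]ffunE -/e -/p; lra.
have Hp : H e p <= crit by move/subsolutionE: u_sub.
have pH : H e p = crit.
  apply/eqP; rewrite eq_le Hp; have := fenchel H e p (speed x).
  by rewrite -/(tangent_lagrangian H x) LE; lra.
split.
  have := @fenchel_eq_sigma _ _ H e p _ (speed_ge0 x).
  rewrite -/(tangent_lagrangian H x) LE pH => /(_ (lexx _)).
  by rewrite /p /sigma_cochain => <-; rewrite addrC addKr.
move=> x0; rewrite -pH; congr (H e _); apply/esym/fenchel_eq_minimizer.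
by rewrite pH -x0 -/(tangent_lagrangian H x) LE x0; lra.
Qed.

Variable mu : probability B R.
Hypothesis mu_min : minimizing_measures H c mu.

Let mu_closed : closed_measures mu := mu_min.1.

Lemma gap_measurable : measurable_fun [set: B] (gap u : B -> R).
Proof. exact: tangent_lagrangian_measurable gap_continuous_part. Qed.

(** The gap is nonnegative, and its integral is the action plus [crit], that is 0, as exact cochains
    integrate to 0. *)
Lemma gap_null : mu [set x | 0 < gap u x] = 0%E.
Proof.
have gapE x : gap u x = lagrangian_cochain H w x - (momentum (differential u) x - crit).
  rewrite /gap /lagrangian_cochain /momentum [(w + _) _]ffunE; ring.
have actionE : action H w mu = (- crit)%:E.
  by have [_ ->] := mu_min; rewrite alpha_critical.
have w_int : mu.-integrable setT (fun x => (lagrangian_cochain H w x)%:E).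
  apply: integrable_lower_bound.
  - apply/measurable_EFinP.
    apply: (@tangent_lagrangian_measurable (fun x => - momentum w x)).
    move=> x; apply: cvgN; [exact: (@nbhs_filter T x)|exact: momentum_continuous].
  - exact: (momentum_sub_integrable mu_closed (differential u) crit).
  - by move=> x; rewrite lee_fin; have := gap_ge0 x; rewrite gapE; lra.
  - by rewrite -/(action H w mu) actionE ltry.
have gap_int : (\int[mu]_x (gap u x)%:E = 0)%E.
  under eq_integral => x _ do rewrite gapE EFinB.
  rewrite integralB_EFin // ; last exact: momentum_sub_integrable.
  rewrite -/(action H w mu) actionE integral_momentum_sub // mu_closed.2.
  by rewrite sub0r -EFinB subrr.
have mgap : measurable_fun [set: B] (fun x => (gap u x)%:E).
  by apply/measurable_EFinP; exact: gap_measurable.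
have : (\int[mu]_x `|(gap u x)%:E| = 0)%E.
  rewrite -[RHS]gap_int; apply: eq_integral => x _.
  by rewrite /= ger0_norm // gap_ge0.
move=> /(ae_eq_integral_abs mu measurableT mgap) ae0.
apply: measure_negligible; first exact: open_tborel_measurable gap_open.
apply: negligibleS ae0 => x /= gap_x /(_ I) [] gap0.
by rewrite gap0 ltxx in gap_x.
Qed.

End Critical.

End Mather.

(** * Comparison of the Mather and Aubry sets *)

Section MatherAubry.
Variables (R : realType) (G : graph) (H : hamiltonian R G).
Variable c : cohomology1 R G.
Local Notation T := (tangent R G).
Local Notation B := (tborel R G).
Local Notation w := (repr c).
Local Notation crit := (critical_value_cochain H (repr c)).

Section Support.
Variable u : vertex G -> R.
Hypothesis u_sub : subsolution H w crit u.
Variable mu : probability B R.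
Hypothesis mu_min : minimizing_measures H c mu.

Let flow (e : edge G) : R := \int[mu]_(x in half_line e) speed x.

Lemma minimizing_flow_cycle e : 0 < flow e ->
  exists xi, [/\ is_cycle xi, e \in xi & forall f, f \in xi -> 0 < flow f].
Proof.
apply: circulation_cycle => [f|f].
  by apply: Rintegral_ge0 => x _; exact: speed_ge0.
have := mu_min.1.2 f; rewrite /cochain_integral pairing_pi => sum0.
by rewrite -[RHS]sum0; apply: eq_bigr => e' _; rewrite !ffunE.
Qed.

(** The conclusion depends on the edge only, so one point of zero gap on the open half-line
    suffices; it exists because this set is not null. *)
Lemma flow_calibrated e : 0 < flow e -> differential u e = sigma_cochain H w e crit.
Proof.
rewrite (half_line_flow_gt0 mu_min.1.1) => muA.
have [[x [xA gap0]]|no_x] := pselect (exists x : T,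
    open_half_line e x /\ gap H c u x = 0).
  move: xA; rewrite open_half_lineE => /andP[_ /eqP <-].
  by have [] := gap_eq0 u_sub gap0.
move: muA; rewrite (_ : mu _ = 0%E) ?eqxx //.
apply: (subset_measure0 _ _ _ (gap_null u_sub mu_min)).
- exact: open_tborel_measurable (@open_half_line_open R G e).
- by apply: open_tborel_measurable; exact: gap_open.
move=> x /= xA; rewrite lt_neqAle gap_ge0 // andbT eq_sym.
by apply/eqP => gap0; apply: no_x; exists x.
Qed.

(** Semicontinuity makes the set of positive gap open; being null, it misses the support, so the
    almost everywhere statement holds at every support point. *)
Lemma support_gap x : msupport mu x -> gap H c u x = 0.
Proof.
move=> x_supp; apply/eqP; rewrite eq_le gap_ge0 // andbT leNgt; apply/negP => gap_x.
by have := x_supp _ (@gap_open _ _ H c u) gap_x; rewrite gap_null // ltxx.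
Qed.

Lemma support_aubry x e : msupport mu x -> edge_proj x e -> aubry_set H c e.
Proof.
move=> x_supp; have [xu x_rest] := gap_eq0 u_sub (support_gap x_supp).
rewrite /edge_proj; case: ifPn => [x_gt0 /= ->|x_le0].
  have flow_e : 0 < flow (tedge x).
    rewrite /flow (half_line_flow_gt0 mu_min.1.1) gt_eqF //.
    apply: (x_supp (open_half_line (tedge x))); first exact: open_half_line_open.
    by rewrite open_half_lineE x_gt0 eqxx.
  have [xi [cyc e_xi xi_flow]] := minimizing_flow_cycle flow_e.
  exists xi; split=> //; rewrite -[RHS](sum_differential_cycle u cyc).
  by apply: eq_big_seq => f /xi_flow/flow_calibrated ->.
have x0 : speed x = 0 by apply/eqP; rewrite eq_le leNgt x_le0 speed_ge0.
move=> xe; exists [:: tedge x; erev (tedge x)]; split.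
- by rewrite /is_cycle /= /follows /term Defs.revK !eqxx.
- by case: xe => /= ->; rewrite !inE eqxx ?orbT.
- exact: critical_eq_min_rev (x_rest x0).
Qed.

End Support.

Lemma projected_mather_sub_aubry : projected_mather_set H c `<=` aubry_set H c.
Proof.
have [u u_sub] := critical_subsolution H w.
by move=> e [x [mu mu_min x_supp] xe]; exact: support_aubry u_sub mu mu_min x e x_supp xe.
Qed.

Lemma aubry_sub_projected_mather : (forall e, H e (minimizer H e) < crit) ->
  aubry_set H c `<=` projected_mather_set H c.
Proof.
move=> crit_gt e [xi [cyc e_xi xi0]].
have xi_nil : xi != [::] by case: xi e_xi {cyc xi0}.
have xi_le : sigma_path H w xi crit <= 0 by rewrite xi0.
have [mu [mu_closed mu_le mu_supp]] := cycle_measure crit_gt xi_nil cyc xi_le.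
have [x x_supp xe] := mu_supp e e_xi.
by exists x => //; exists mu => //; exact: minimizing_measure.
Qed.

End MatherAubry.

Theorem corollary8p3 (R : realType) (G : graph) (H : hamiltonian R G)
    (G_connected : connected_graph G) (G_loopless : loopless G)
    (c : cohomology1 R G) :
  (projected_mather_set H c `<=` aubry_set H c) /\
  ((ereal_inf (range (alpha H)) < alpha H c)%E ->
     projected_mather_set H c = aubry_set H c).
Proof.
split=> [|inf_lt]; first exact: projected_mather_sub_aubry.
apply/seteqP; split; first exact: projected_mather_sub_aubry.
apply: aubry_sub_projected_mather => e.
(* The minimum level of [e] is below every value of [alpha], hence below their infimum. *)
rewrite -lte_fin -alpha_critical; apply: le_lt_trans inf_lt.
apply: le_ereal_inf_tmp => _ [c' _ <-].
by rewrite alpha_critical lee_fin critical_ge_min.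
Qed.
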